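(* Let $\mathcal C$ be an admissible class of graphons, and let $H$ be a finite graph with $v(H)\le e(H)$. Then $H$ is $\mathcal C$-Sidorenko if and only if it is spectrally $\mathcal C$-Sidorenko. Equivalently, the following two statements are equivalent: (i) for every $W\in\mathcal C$, $\;t(H,W)\ge p(W)^{e(H)}$; (ii) for every non-zero $W\in\mathcal C$, $\;t(H,W)\ge \rho(W)^{2e(H)-v(H)}\,p(W)^{v(H)-e(H)}$.
   Context: All underlying probability spaces $(\Omega,\mu)$ are standard and atomless (so isomorphic to $[0,1]$ with Lebesgue measure). A graphon is a symmetric measurable function $W:\Omega^2\to[0,1]$ on such a space; non-zero means not almost everywhere $0$. Graphs are finite and simple, with at least one edge; isolated vertices are deleted, so $v(H)$ denotes the number of non-isolated vertices of $H$ and $e(H)$ the number of edges. The homomorphism density is $t(H,W)=\int_{\Omega^{V(H)}}\prod_{uv\in E(H)}W(x_u,x_v)\prod_{u\in V(H)}d\mu(x_u)$, and $p(W)=t(K_2,W)=\int_{\Omega^2}W\,d\mu\,d\mu$. The operator $T_W$ on $L^2(\Omega)$ is $T_Wf(x)=\int_\Omega W(x,y)f(y)\,d\mu(y)$, and $\rho(W)=\|T_W\|_{2\to2}$ is its operator norm. For $k\ge1$, the tensor power $W^{\otimes k}$ is the graphon on $(\Omega^k,\mu^k)$ given by $W^{\otimes k}(x,y)=\prod_{r=1}^kW(x_r,y_r)$. For measurable $S\subseteq\Omega$ with $\alpha=\mu(S)>0$, the normalized principal restriction $W[S]$ is the graphon on $(S,\mu|_S/\alpha)$ given by $W[S](x,y)=W(x,y)$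 for $x,y\in S$. A class $\mathcal C$ of graphons (considered up to measure-preserving isomorphism of the underlying standard atomless probability spaces) is admissible if: (A1) $W\in\mathcal C$ implies $W^{\otimes k}\in\mathcal C$ for every $k\ge1$; (A2) $W\in\mathcal C$ and $S$ a positive-measure measurable subset of the underlying space of $W$ imply $W[S]\in\mathcal C$. $H$ is called $\mathcal C$-Sidorenko if (i) holds, and (when $v(H)\le e(H)$) spectrally $\mathcal C$-Sidorenko if (ii) holds. *)

(* Defs.v *)
From HB Require Import structures.
From mathcomp Require Import all_boot all_order all_algebra.
From mathcomp Require Import all_classical all_reals all_analysis.

Set Implicit Arguments.
Unset Strict Implicit.
Unset Printing Implicit Defensive.
Import Order.TTheory GRing.Theory Num.Theory.
Import numFieldNormedType.Exports.

Local Open Scope classical_set_scope.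
Local Open Scope ring_scope.

Section tuple_probability.
Context d (T : measurableType d) (R : realType).

Definition tuple_cons n (z : T * n.-tuple T) : n.+1.-tuple T :=
  [tuple of z.1 :: z.2].

Lemma measurable_tuple_cons n : measurable_fun setT (@tuple_cons n).
Proof. exact: measurable_cons. Qed.

HB.instance Definition _ n :=
  isMeasurableFun.Build _ _ _ _ (@tuple_cons n) (@measurable_tuple_cons n).

(* The n-fold product of [P]: the library has the product sigma-algebra on
   [n.-tuple T], but not the product measure. *)
Fixpoint tuple_prob (P : probability T R) n : probability (n.-tuple T) R :=
  match n with
  | 0 => [the probability (0.-tuple T) R of dirac [tuple]]
  | m.+1 =>
    distribution [the probability _ R of (P \x tuple_prob P m)%E]
      [the {mfun _ >-> _} of @tuple_cons m]
  end.

End tuple_probability.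

(* Measurable types are pointed, so the carrier has to remember that [S] has
   positive measure. *)
Definition restr_space d (T : measurableType d) (R : realType)
  (P : probability T R) (S : set T) (S0 : (0 < P S)%E) : Type := set_type S.

Section restriction.
Context d (T : measurableType d) (R : realType) (P : probability T R).
Variables (S : set T) (mS : measurable S) (S0 : (0 < P S)%E).

Local Notation TS := (restr_space S0).

Definition restr_incl (x : TS) : T := val x.

Lemma restr_space_nonempty : exists x : T, x \in S.
Proof.
have [S_eq0|/set0P[x Sx]] := eqVneq S set0; last by exists x; rewrite inE.
by move: S0; rewrite S_eq0 measure0 ltxx.
Qed.

HB.instance Definition _ := Choice.copy TS (set_type S).
HB.instance Definition _ := isPointed.Build TS
  (exist _ (projT1 (cid restr_space_nonempty))
     (projT2 (cid restr_space_nonempty))).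
HB.instance Definition _ := Measurable.copy TS
  (g_sigma_algebra_preimageType restr_incl).

Definition restr_measure (A : set TS) : \bar R :=
  (P (restr_incl @` A) * (fine (P S))^-1%:E)%E.

Lemma restr_incl_preimage (B : set T) :
  restr_incl @` (restr_incl @^-1` B) = B `&` S.
Proof.
rewrite eqEsubset; split => [_ [[x xS] /= Bx <-]|x [Bx Sx]].
  by split => //; exact: set_mem.
by exists (exist _ x (mem_set Sx)).
Qed.

Lemma measurable_restr_image (A : set TS) :
  measurable A -> measurable (restr_incl @` A).
Proof.
move=> [B mB <-]; rewrite setTI restr_incl_preimage.
exact: measurableI.
Qed.

Let restr_measure0 : restr_measure set0 = 0%E.
Proof. by rewrite /restr_measure image_set0 measure0 mul0e. Qed.

Let restr_measure_ge0 A : (0 <= restr_measure A)%E.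
Proof.
rewrite /restr_measure mule_ge0// lee_fin invr_ge0 fine_ge0//.
Qed.

Let restr_measure_sigma_additive : semi_sigma_additive restr_measure.
Proof.
move=> F mF tF mUF; rewrite /restr_measure image_bigcup.
rewrite [X in X @ _ --> _](_ : _ =
    (fun n => \sum_(0 <= i < n) P (restr_incl @` F i)) \*
    cst (fine (P S))^-1%:E)%E; last first.
  by apply/funext => n; rewrite -ge0_sume_distrl.
apply: cvgeZr => //; apply: measure_semi_sigma_additive => //.
- by move=> i; exact: measurable_restr_image.
- apply/trivIsetP => i j _ _ ij.
  rewrite -subset0 => _ [[x Fx <-] [y Fy /val_inj yx]].
  move/trivIsetP : tF => /(_ i j I I ij); rewrite -subset0; apply.
  by split; [exact: Fx|rewrite -yx].
- by rewrite -image_bigcup; exact: measurable_restr_image.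
Qed.

HB.instance Definition _ := isMeasure.Build _ _ _ restr_measure
  restr_measure0 restr_measure_ge0 restr_measure_sigma_additive.

Let restr_measure_setT : restr_measure setT = 1%E.
Proof.
have Sfin : P S \is a fin_num by exact: fin_num_measure.
rewrite /restr_measure -(preimage_setT restr_incl) restr_incl_preimage setTI.
rewrite -{1}(fineK Sfin) -EFinM divff// fine_eq0//.
by rewrite gt_eqF.
Qed.

HB.instance Definition _ := Measure_isProbability.Build _ _ _ restr_measure
  restr_measure_setT.

Definition restr_prob : probability TS R := restr_measure.

End restriction.

(* A symmetric measurable [0,1]-valued kernel on an arbitrary probability
   space; [is_graphon] below adds that the space is standard and atomless. *)
Record symkernel (R : realType) := Kernel {
  ker_display : measure_display;
  space : measurableType ker_display;
  prob : probability space R;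
  ker :> space -> space -> R;
  measurable_ker : measurable_fun setT (fun z : space * space => ker z.1 z.2);
  ker_sym : forall x y, ker x y = ker y x;
  ker_itv : forall x y, 0 <= ker x y <= 1 }.

Arguments space {R} _.
Arguments prob {R} _.
Arguments measurable_ker {R} _.
Arguments ker_sym {R} _ _ _.
Arguments ker_itv {R} _ _ _.

(* [f] and [g] are mutually inverse up to null sets. *)
Definition iso_mod0 (R : realType) d1 d2 (T1 : measurableType d1)
    (T2 : measurableType d2) (m1 : {measure set T1 -> \bar R})
    (m2 : {measure set T2 -> \bar R}) (f : T1 -> T2) (g : T2 -> T1) :=
  [/\ measurable_fun setT f, measurable_fun setT g,
      forall A, measurable A -> m1 (f @^-1` A) = m2 A,
      \forall x \ae m1, g (f x) = x
    & \forall y \ae m2, f (g y) = y].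

(* The complement of [0,1] is null for the target measure, so this is an
   isomorphism mod 0 with [0,1] under Lebesgue measure. *)
Definition standard_atomless (R : realType) d (T : measurableType d)
    (P : probability T R) :=
  exists (f : T -> measurableTypeR R) (g : measurableTypeR R -> T),
    iso_mod0 P (mrestr lebesgue_measure (measurable_itv `[(0 : R), 1])) f g.

Definition is_graphon (R : realType) (W : symkernel R) :=
  standard_atomless (prob W).

Definition graphon_iso (R : realType) (W V : symkernel R) :=
  exists (f : space W -> space V) (g : space V -> space W),
    iso_mod0 (prob W) (prob V) f g /\
    \forall z \ae (prob W \x prob W)%E, W z.1 z.2 = V (f z.1) (f z.2).

Definition nonzero (R : realType) (W : symkernel R) :=
  ~ \forall z \ae (prob W \x prob W)%E, W z.1 z.2 = 0.

Section kernel_operations.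
Context (R : realType) (W : symkernel R).

Definition tensor_fun k (x y : k.-tuple (space W)) : R :=
  \prod_(r < k) W (tnth x r) (tnth y r).

Lemma measurable_tensor_fun k : measurable_fun setT
  (fun z : k.-tuple (space W) * k.-tuple (space W) => tensor_fun z.1 z.2).
Proof.
apply: measurable_prod => r _ /=.
have mr : measurable_fun setT (fun z : k.-tuple (space W) * k.-tuple (space W) =>
    (tnth z.1 r, tnth z.2 r)).
  apply/measurable_fun_pairP; split => /=.
    exact: (measurableT_comp (measurable_tnth r) measurable_fst).
  exact: (measurableT_comp (measurable_tnth r) measurable_snd).
exact: (measurableT_comp (measurable_ker W) mr).
Qed.

Lemma tensor_fun_sym k (x y : k.-tuple (space W)) :
  tensor_fun x y = tensor_fun y x.
Proof. by apply: eq_bigr => r _; rewrite ker_sym. Qed.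

Lemma tensor_fun_itv k (x y : k.-tuple (space W)) :
  0 <= tensor_fun x y <= 1.
Proof.
apply/andP; split.
  by apply: prodr_ge0 => r _; case/andP: (ker_itv W (tnth x r) (tnth y r)).
by apply: numdomain.Num.Theory.prodr_ile1 => r _; exact: ker_itv.
Qed.

Definition tensor_power (k : nat) : symkernel R :=
  @Kernel R _ (k.-tuple (space W))%type (tuple_prob (prob W) k)
    (@tensor_fun k) (@measurable_tensor_fun k) (@tensor_fun_sym k)
    (@tensor_fun_itv k).

Variables (S : set (space W)) (mS : measurable S) (S0 : (0 < prob W S)%E).

Definition restr_fun (x y : restr_space S0) : R :=
  W (restr_incl x) (restr_incl y).

Lemma measurable_restr_incl : measurable_fun setT (@restr_incl _ _ _ _ _ S0).
Proof. by move=> _ B mB; exists B. Qed.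

Lemma measurable_restr_fun : measurable_fun setT
  (fun z : restr_space S0 * restr_space S0 => restr_fun z.1 z.2).
Proof.
have mS2 : measurable_fun setT (fun z : restr_space S0 * restr_space S0 =>
    (restr_incl z.1, restr_incl z.2)).
  apply/measurable_fun_pairP; split => /=.
    exact: (measurableT_comp measurable_restr_incl measurable_fst).
  exact: (measurableT_comp measurable_restr_incl measurable_snd).
exact: (measurableT_comp (measurable_ker W) mS2).
Qed.

Definition restriction : symkernel R :=
  @Kernel R _ (restr_space S0) (restr_prob mS S0) restr_fun
    measurable_restr_fun (fun x y => ker_sym W _ _) (fun x y => ker_itv W _ _).

End kernel_operations.

(* A class of graphons is a predicate on representatives.  Since tensor powers
   and restrictions of graphons are again graphons, asking that the members of
   [C] be graphons does not restrict the two closure conditions. *)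
Record admissible (R : realType) (C : symkernel R -> Prop) : Prop := Admissible {
  admissible_graphon : forall W, C W -> is_graphon W;
  admissible_iso : forall W V, C W -> graphon_iso W V -> C V;
  admissible_tensor : forall W k, C W -> (1 <= k)%N -> C (tensor_power W k);
  admissible_restriction : forall W S (mS : measurable S)
    (S0 : (0 < prob W S)%E), C W -> C (restriction mS S0) }.

Record graph := Graph {
  vertex : finType;
  adj : rel vertex;
  adj_sym : symmetric adj;
  adj_irr : irreflexive adj;
  has_edge : exists u v, adj u v }.

(* Each edge is listed once, in the orientation that is increasing for the
   enumeration of the vertices. *)
Definition edges (H : graph) : {set vertex H * vertex H} :=
  [set p | adj p.1 p.2 & (enum_rank p.1 < enum_rank p.2)%N].

Definition num_edges (H : graph) : nat := #|edges H|.

(* Isolated vertices do not count. *)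
Definition num_vertices (H : graph) : nat :=
  #|[set u : vertex H | [exists v, adj u v]]|.

Section parameters.
Context (R : realType) (W : symkernel R).

(* The coordinate of [x] at the vertex [u] is [tnth x (enum_rank u)];
   isolated vertices integrate to 1. *)
Definition hom_density (H : graph) : R :=
  \int[tuple_prob (prob W) #|vertex H|]_x
    \prod_(p in edges H) W (tnth x (enum_rank p.1)) (tnth x (enum_rank p.2)).

Definition edge_density : R := \int[(prob W \x prob W)%E]_z W z.1 z.2.

Definition kernel_op (f : space W -> R) (x : space W) : R :=
  \int[prob W]_y (W x y * f y).

Definition L2norm (f : space W -> R) : R :=
  fine ('N[prob W]_2%:E[EFin \o f])%E.

Definition op_norm : R :=
  sup [set L2norm (kernel_op f) | f in
    [set f | f \in Lfun (prob W) 2%:E /\ L2norm f <= 1]].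

End parameters.

Definition Sidorenko (R : realType) (C : symkernel R -> Prop) (H : graph) :=
  forall W, C W -> edge_density W ^+ num_edges H <= hom_density W H.

Definition spectrally_Sidorenko (R : realType) (C : symkernel R -> Prop)
    (H : graph) :=
  forall W, C W -> nonzero W ->
    op_norm W ^ ((2 * num_edges H)%:Z - (num_vertices H)%:Z) *
      edge_density W ^ ((num_vertices H)%:Z - (num_edges H)%:Z)
    <= hom_density W H.

(* Main.v *)
From mathcomp Require Import all_boot all_order all_algebra.
From mathcomp Require Import all_classical all_reals all_analysis.
From mathcomp Require Import measurable_realfun zify ring lra.
Require Import Defs.

Set Implicit Arguments.
Unset Strict Implicit.
Unset Printing Implicit Defensive.
Import Order.TTheory GRing.Theory Num.Theory.
Import numFieldNormedType.Exports.

Local Open Scope classical_set_scope.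
Local Open Scope ring_scope.

(** Why the theorem holds.  Write [v], [e] for the numbers of vertices and
    edges, [p], [rho], [t] for the edge density, the operator norm and the
    homomorphism density of a graphon [W].

    The spectral bound implies the plain one because [p <= rho] (test the
    operator on the constant 1) and [2 * e - v] is nonnegative.

    For the converse, restrict a tensor power [U] of [W] to a set [S] of
    measure [s].  Restriction multiplies the homomorphism density by at most
    [s ^- v] and the edge density becomes the weight of [S] divided by
    [s ^+ 2], so the Sidorenko inequality for [U[S]] bounds [t] of [U] below by
    (weight of [S]) ^ e * s ^ (v - 2e).  It remains to find, in a high tensor
    power, a set [S] whose weight is about [rho ^+ k * s]: since that weight is
    at most [p ^+ k], the set is then automatically as small as about
    [(p / rho) ^+ k], and because [v <= e] this turns the bound into
    [t ^+ k >= (rho ^ (2e - v) * p ^ (v - e)) ^+ k] up to subexponential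
    factors.

    To find [S], take nonnegative [f] and [h] for which the form
    K = int h W f is close to [rho] times the product of their norms; they may
    be taken simple ([exists_simple_pair]).  In the [k]-th tensor power the
    functions f(x_1)...f(x_k) and h(x_1)...h(x_k) take only polynomially many
    values in [k] ([finite_range_prod]), so by pigeonhole a single pair of level
    sets [A], [B] carries a polynomial fraction of [K ^+ k], which makes the
    weight between [A] and [B] at least about [rho ^+ k] times the geometric
    mean of their measures ([exists_level_sets]).  The pair [A], [B] need not
    be a single set, nor have equal measures; but in the square of the tensor
    power the boxes A x B and B x A do have equal measures, and their union is
    the set [S] that is wanted ([exists_swap_set]).  Letting [k] grow removes
    the polynomial factors ([le_of_exprn_le_poly]). *)

Arguments tuple_prob : simpl never.

(** * Integration over finite powers of a probability space *)

Section tuple_integrals.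
Context (R : realType) d (T : measurableType d) (P : probability T R).
Local Open Scope ereal_scope.

Lemma ge0_integral_tuple0 (F : 0.-tuple T -> \bar R) :
  measurable_fun [set: 0.-tuple T] F -> \int[tuple_prob P 0]_x F x = F [tuple].
Proof. by move=> mF; rewrite integral_dirac// diracT mul1e. Qed.

Lemma ge0_integral_tupleS n (F : n.+1.-tuple T -> \bar R) :
  measurable_fun [set: n.+1.-tuple T] F -> (forall x, 0 <= F x) ->
  \int[tuple_prob P n.+1]_x F x =
  \int[P]_t \int[tuple_prob P n]_x F [tuple of t :: x].
Proof.
move=> mF F0; rewrite [LHS]ge0_integral_distribution//.
rewrite fubini_tonelli1//; last by move=> z; exact: F0.
exact: (measurableT_comp mF (@measurable_tuple_cons _ T n)).
Qed.

End tuple_integrals.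

Lemma measurable_ge0_integral (R : realType) d1 d2 (T1 : measurableType d1)
    (T2 : measurableType d2) (P2 : probability T2 R) (f : T1 * T2 -> \bar R) :
    measurable_fun setT f -> (forall x y, 0 <= f (x, y))%E ->
  measurable_fun setT (fun x => \int[P2]_y f (x, y))%E.
Proof.
by move=> mf f0; apply: (measurable_fun_fubini_tonelli_F _ mf); case.
Qed.

Lemma ge0_integral_prod (R : realType) d1 d2 (T1 : measurableType d1)
    (T2 : measurableType d2) (P1 : probability T1 R) (P2 : probability T2 R)
    (f : T1 * T2 -> \bar R) :
    measurable_fun setT f -> (forall x y, 0 <= f (x, y))%E ->
  (\int[(P1 \x P2)]_z f z = \int[P1]_x \int[P2]_y f (x, y))%E.
Proof. by move=> mf f0; apply: (fubini_tonelli1 _ mf); case. Qed.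

Lemma ge0_integral_prodM (R : realType) d1 d2 (T1 : measurableType d1)
    (T2 : measurableType d2) (P1 : probability T1 R) (P2 : probability T2 R)
    (f : T1 -> \bar R) (g : T2 -> \bar R) :
    measurable_fun setT f -> measurable_fun setT g ->
    (forall x, 0 <= f x)%E -> (forall y, 0 <= g y)%E ->
  (\int[P1]_x \int[P2]_y (f x * g y) = (\int[P1]_x f x) * (\int[P2]_y g y))%E.
Proof.
move=> mf mg f0 g0.
under eq_integral do rewrite ge0_integralZl//.
by rewrite ge0_integralZr//; exact: integral_ge0.
Qed.

Section tensor_integrals.
Context (R : realType) d (T : measurableType d) (P : probability T R).
Local Open Scope ereal_scope.

Lemma measurable_tensor_pair k (G : 'I_k -> T * T -> R) :
  (forall r, measurable_fun setT (G r)) -> measurable_fun setT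
   (fun z : k.-tuple T * k.-tuple T =>
      \prod_(r < k) G r (tnth z.1 r, tnth z.2 r))%R.
Proof.
move=> mG; apply: measurable_prod => r _ /=.
apply: (measurableT_comp (mG r)); apply/measurable_fun_pairP; split => /=.
  exact: (measurableT_comp (measurable_tnth r) measurable_fst).
exact: (measurableT_comp (measurable_tnth r) measurable_snd).
Qed.

(** The pairs of [r]-th coordinates of two independent points of [T ^ k] are
    independent of each other as [r] varies, so the integral factors. *)
Lemma ge0_integral_tensor_pair k (G : 'I_k -> T * T -> R) :
    (forall r, measurable_fun setT (G r)) -> (forall r z, (0 <= G r z)%R) ->
  \int[(tuple_prob P k \x tuple_prob P k)]_z
    (\prod_(r < k) G r (tnth z.1 r, tnth z.2 r))%:E =
  \prod_(r < k) \int[(P \x P)]_z (G r z)%:E.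
Proof.
elim: k G => [|k IH] G mG G0.
  rewrite big_ord0 (eq_integral (cst 1)); last by move=> z _; rewrite big_ord0.
  rewrite integral_cst// mul1e; exact: probability_setT.
pose Gk := fun r : 'I_k => G (lift ord0 r).
have mG0 : measurable_fun setT (EFin \o G ord0) by exact/measurable_EFinP.
have mall : measurable_fun setT (fun z : k.+1.-tuple T * k.+1.-tuple T =>
    (\prod_(r < k.+1) G r (tnth z.1 r, tnth z.2 r))%:E).
  by apply/measurable_EFinP; exact: (measurable_tensor_pair mG).
have mtail : measurable_fun setT (fun z : k.-tuple T * k.-tuple T =>
    (\prod_(r < k) Gk r (tnth z.1 r, tnth z.2 r))%:E).
  apply/measurable_EFinP.
  by apply: (@measurable_tensor_pair k Gk) => r; exact: mG.
have all0 (x y : k.+1.-tuple T) :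
    0 <= (\prod_(r < k.+1) G r (tnth x r, tnth y r))%:E.
  by rewrite lee_fin prodr_ge0.
have tail0 (x y : k.-tuple T) :
    0 <= (\prod_(r < k) Gk r (tnth x r, tnth y r))%:E.
  by rewrite lee_fin; apply: prodr_ge0 => r _; exact: G0.
have mF0 := measurable_ge0_integral P mG0 (fun _ _ => G0 _ _).
have mFtail := measurable_ge0_integral (tuple_prob P k) mtail tail0.
have mFall := measurable_ge0_integral (tuple_prob P k.+1) mall all0.
rewrite (ge0_integral_prod _ _ mall)//.
rewrite (ge0_integral_tupleS _ mFall); last first.
  by move=> x; apply: integral_ge0 => y _; exact: all0.
transitivity (\int[P]_t \int[tuple_prob P k]_x
    ((\int[P]_s (G ord0 (t, s))%:E) *
     \int[tuple_prob P k]_y (\prod_(r < k) Gk r (tnth x r, tnth y r))%:E)).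
  apply: eq_integral => t _; apply: eq_integral => x _.
  rewrite (ge0_integral_tupleS _
    (measurable_fun_pair2 [tuple of t :: x] mall)) //.
  rewrite -(ge0_integral_prodM P (tuple_prob P k) (measurable_fun_pair2 t mG0)
    (measurable_fun_pair2 x mtail)) //; last by move=> s; rewrite lee_fin.
  apply: eq_integral => s _; apply: eq_integral => y _.
  rewrite -EFinM big_ord_recl /= !tnth0; congr (_ * _)%:E.
  by apply: eq_bigr => r _; rewrite !tnthS.
rewrite (ge0_integral_prodM P (tuple_prob P k) mF0 mFtail); last 2 first.
- by move=> t; apply: integral_ge0 => s _; rewrite lee_fin.
- by move=> x; apply: integral_ge0 => y _; exact: tail0.
rewrite big_ord_recl -(IH Gk) //; last 2 first.
- by move=> r; exact: mG.
- by move=> r z; exact: G0.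
rewrite (ge0_integral_prod _ _ mG0); last by move=> x y; rewrite lee_fin.
by rewrite (ge0_integral_prod _ _ mtail).
Qed.

Lemma ge0_integral_tensor k (f : 'I_k -> T -> R) :
    (forall r, measurable_fun setT (f r)) -> (forall r x, (0 <= f r x)%R) ->
  \int[tuple_prob P k]_x (\prod_(r < k) f r (tnth x r))%:E =
  \prod_(r < k) \int[P]_x (f r x)%:E.
Proof.
move=> mf f0.
have mfE j (F : j.-tuple T -> R) : measurable_fun [set: j.-tuple T] F ->
    measurable_fun setT (fun z : j.-tuple T * j.-tuple T => (F z.1)%:E).
  by move=> mF; apply/measurable_EFinP; exact: measurableT_comp.
have mprod : measurable_fun [set: k.-tuple T]
    (fun x : k.-tuple T => \prod_(r < k) f r (tnth x r))%R.
  apply: measurable_prod => r _ /=.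
  exact: (measurableT_comp (mf r) (measurable_tnth r)).
have mfr r : measurable_fun setT (fun z : T * T => f r z.1).
  exact: (measurableT_comp (mf r) measurable_fst).
have fst_int d' (X : measurableType d') (Q : probability X R) (g : X -> R) :
    measurable_fun setT (fun z : X * X => (g z.1)%:E) ->
    (forall x, (0 <= g x)%R) ->
    \int[(Q \x Q)]_z (g z.1)%:E = \int[Q]_x (g x)%:E.
  move=> mg g0; rewrite (ge0_integral_prod _ _ mg); last first.
    by move=> x y; rewrite lee_fin.
  apply: eq_integral => x _ /=.
  by rewrite integral_cst// [X in _ * X]probability_setT mule1.
rewrite -(fst_int _ _ (tuple_prob P k) (fun x => \prod_(r < k) f r (tnth x r))%R
  (mfE _ _ mprod)); last by move=> x; exact: prodr_ge0.
rewrite [LHS](ge0_integral_tensor_pair mfr) //.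
apply: eq_bigr => r _; apply: fst_int => //.
apply/measurable_EFinP; exact: mfr.
Qed.

End tensor_integrals.

(** With [c] the map that prepends a coordinate, the points [x] of [T ^ n] and
    [u] of [(T ^ k) ^ n] zip to a point of [(T ^ k.+1) ^ n]: this peels one
    tensor factor off an integral over [n]-tuples of [k.+1]-tuples. *)
Section zipped_tuples.
Context (R : realType) d1 d2 d3 (T : measurableType d1) (U : measurableType d2)
  (Z : measurableType d3) (P : probability T R) (Q : probability U R)
  (c : {mfun (T * U)%type >-> Z}).
Local Open Scope ereal_scope.

Definition tuple_zip n (x : n.-tuple T) (u : n.-tuple U) : n.-tuple Z :=
  [tuple c (tnth x i, tnth u i) | i < n].

Lemma tuple_zip_cons n t (x : n.-tuple T) v (u : n.-tuple U) :
  tuple_zip [tuple of t :: x] [tuple of v :: u] =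
  [tuple of c (t, v) :: tuple_zip x u].
Proof.
apply: eq_from_tnth => i; rewrite tnth_mktuple.
case: (unliftP ord0 i) => [j ->|->]; last by rewrite !tnth0.
by rewrite !tnthS tnth_mktuple.
Qed.

Lemma measurable_tuple_zip n : measurable_fun setT
  (fun z : n.-tuple T * n.-tuple U => tuple_zip z.1 z.2).
Proof.
apply/measurable_fun_tnthP => i.
rewrite (_ : _ \o _ = fun z : n.-tuple T * n.-tuple U =>
    c (tnth z.1 i, tnth z.2 i)); last first.
  by apply/funext => z /=; rewrite tnth_mktuple.
apply: (measurableT_comp (measurable_funPT c)).
apply/measurable_fun_pairP; split => /=.
  exact: (measurableT_comp (measurable_tnth i) measurable_fst).
exact: (measurableT_comp (measurable_tnth i) measurable_snd).
Qed.

Local Notation PQ := (distribution [the probability _ R of (P \x Q)] c).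

(** By induction on [n]: both sides integrate over the same independent
    coordinates, and Tonelli exchanges the first point of [U] with the remaining
    points of [T]. *)
Lemma ge0_integral_tuple_zip n (F : n.-tuple Z -> \bar R) :
  measurable_fun [set: n.-tuple Z] F -> (forall x, 0 <= F x) ->
  \int[tuple_prob PQ n]_z F z =
  \int[tuple_prob P n]_x \int[tuple_prob Q n]_u F (tuple_zip x u).
Proof.
elim: n F => [|n IH] F mF F0.
  have mFz : measurable_fun setT (fun z : 0.-tuple T * 0.-tuple U =>
      F (tuple_zip z.1 z.2)).
    exact: (measurableT_comp mF (@measurable_tuple_zip 0)).
  have mFz1 := measurable_ge0_integral (tuple_prob Q 0) mFz (fun _ _ => F0 _).
  rewrite (ge0_integral_tuple0 _ mF) (ge0_integral_tuple0 _ mFz1).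
  rewrite (ge0_integral_tuple0 _ (measurable_fun_pair2 _ mFz)) /=.
  by congr F; apply: eq_from_tnth => -[].
have mFz : measurable_fun setT (fun z : n.+1.-tuple T * n.+1.-tuple U =>
    F (tuple_zip z.1 z.2)).
  exact: (measurableT_comp mF (@measurable_tuple_zip n.+1)).
have mF2 : measurable_fun setT
    (fun z : Z * n.-tuple Z => F [tuple of z.1 :: z.2]).
  apply: (measurableT_comp mF).
  exact: (measurable_cons measurable_fst measurable_snd).
have mF1 := measurable_ge0_integral (tuple_prob PQ n) mF2 (fun _ _ => F0 _).
have mF3 (t : T) : measurable_fun setT
    (fun z : U * n.-tuple T * n.-tuple U =>
     F (tuple_zip [tuple of t :: z.1.2] [tuple of z.1.1 :: z.2])).
  have mtz : measurable_fun setT (fun z : U * n.-tuple T * n.-tuple U =>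
    ([tuple of t :: z.1.2], [tuple of z.1.1 :: z.2])); last first.
    exact: (measurableT_comp mFz mtz).
  apply/measurable_fun_pairP; split => /=.
    apply: measurable_cons; first exact: measurable_cst.
    exact: (measurableT_comp measurable_snd measurable_fst).
  apply: measurable_cons; last exact: measurable_snd.
  exact: (measurableT_comp measurable_fst measurable_fst).
rewrite (ge0_integral_tupleS _ mF F0).
rewrite (ge0_integral_distribution _ mF1); last first.
  by move=> z; apply: integral_ge0 => w _; exact: F0.
rewrite [LHS](ge0_integral_prod P Q
    (measurableT_comp mF1 (measurable_funPT c)));
  last by move=> t v; apply: integral_ge0 => w _; exact: F0.
have mFR := measurable_ge0_integral (tuple_prob Q n.+1) mFz (fun _ _ => F0 _).
rewrite (ge0_integral_tupleS _ mFR); last first.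
  by move=> x; apply: integral_ge0 => u _; exact: F0.
apply: eq_integral => t _ /=.
transitivity (\int[Q]_v \int[tuple_prob P n]_x \int[tuple_prob Q n]_u
    F (tuple_zip [tuple of t :: x] [tuple of v :: u])).
  apply: eq_integral => v _; rewrite (IH _ (measurable_fun_pair2 _ mF2))//.
  apply: eq_integral => x _; apply: eq_integral => u _.
  by rewrite tuple_zip_cons.
rewrite (fubini_tonelli _
    (measurable_ge0_integral (tuple_prob Q n) (mF3 t) (fun _ _ => F0 _))).
  apply: eq_integral => x _.
  by rewrite (ge0_integral_tupleS _ (measurable_fun_pair2 _ mFz)).
by move=> z; apply: integral_ge0 => u _; exact: F0.
Qed.

End zipped_tuples.

(** * Homomorphism densities of tensor powers and restrictions *)

Lemma EFin_Rintegral01 (R : realType) d (T : measurableType d)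
    (P : probability T R) (f : T -> R) :
    measurable_fun setT f -> (forall x, 0 <= f x <= 1) ->
  ((\int[P]_x f x)%:E = \int[P]_x (f x)%:E)%E.
Proof.
move=> mf f01; rewrite /Rintegral fineK// ge0_fin_numE; last first.
  by apply: integral_ge0 => x _; rewrite lee_fin; case/andP: (f01 x).
apply: (@le_lt_trans _ _ (\int[P]_x (cst 1 x))%E); last first.
  by rewrite integral_cst// mul1e [ltLHS]probability_setT ltry.
apply: (ge0_le_integral P measurableT) => [x _|||x _].
- by rewrite lee_fin; case/andP: (f01 x).
- exact/measurable_EFinP.
- exact: measurable_cst.
- by rewrite lee_fin; case/andP: (f01 x).
Qed.

Lemma le_Rintegral01 (R : realType) d (T : measurableType d)
    (P : probability T R) (f g : T -> R) :
    measurable_fun setT f -> measurable_fun setT g ->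
    (forall x, 0 <= f x <= 1) -> (forall x, 0 <= g x <= 1) ->
    (forall x, f x <= g x) ->
  \int[P]_x f x <= \int[P]_x g x.
Proof.
move=> mf mg f01 g01 fg; rewrite -lee_fin !EFin_Rintegral01//.
apply: (ge0_le_integral P measurableT) => [x _|||x _].
- by rewrite lee_fin; case/andP: (f01 x).
- exact/measurable_EFinP.
- exact/measurable_EFinP.
- by rewrite lee_fin.
Qed.

Section hom_function.
Context (R : realType) (H : graph).
Implicit Types W : symkernel R.

Definition hom_fun W (x : #|vertex H|.-tuple (space W)) : R :=
  \prod_(p in edges H) W (tnth x (enum_rank p.1)) (tnth x (enum_rank p.2)).

Lemma measurable_hom_fun W :
  measurable_fun [set: #|vertex H|.-tuple (space W)] (@hom_fun W).
Proof.
rewrite /hom_fun; under eq_fun do rewrite -big_filter.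
apply: measurable_prod => p _ /=.
have mp : measurable_fun setT (fun x : #|vertex H|.-tuple (space W) =>
    (tnth x (enum_rank p.1), tnth x (enum_rank p.2))).
  by apply/measurable_fun_pairP; split; exact: measurable_tnth.
exact: (measurableT_comp (measurable_ker W) mp).
Qed.

Lemma hom_fun_itv W x : 0 <= @hom_fun W x <= 1.
Proof.
apply/andP; split.
  by apply: prodr_ge0 => p _; case/andP: (ker_itv W (tnth x (enum_rank p.1))
    (tnth x (enum_rank p.2))).
by apply: numdomain.Num.Theory.prodr_ile1 => p _; exact: ker_itv.
Qed.

Lemma EFin_hom_density W : ((hom_density W H)%:E =
  \int[tuple_prob (prob W) #|vertex H|]_x (hom_fun x)%:E)%E.
Proof.
exact: (EFin_Rintegral01 _ (@measurable_hom_fun W) (@hom_fun_itv W)).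
Qed.

Lemma EFin_edge_density W :
  ((edge_density W)%:E = \int[(prob W \x prob W)]_z (W z.1 z.2)%:E)%E.
Proof.
apply: (EFin_Rintegral01 _ (measurable_ker W)) => z; exact: ker_itv.
Qed.

(** The edge weights of a tensor power factor over the tensor coordinates, and
    so does the law of the vertices. *)
Lemma hom_density_tensor W k :
  hom_density (tensor_power W k) H = hom_density W H ^+ k.
Proof.
have mh V := (measurable_EFinP _ _).2 (@measurable_hom_fun V).
have h0 V x : (0 <= (@hom_fun V x)%:E)%E.
  by rewrite lee_fin; case/andP: (hom_fun_itv x).
apply: EFin_inj; elim: k => [|k IH].
  rewrite EFin_hom_density expr0 (eq_integral (cst 1%E)); last first.
    move=> x _ /=; congr (_%:E); apply: big1 => p _.
    exact: big_ord0.
  rewrite integral_cst// mul1e; exact: probability_setT.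
rewrite EFin_hom_density.
rewrite [LHS](ge0_integral_tuple_zip (prob W) (tuple_prob (prob W) k)
  [the {mfun _ >-> _} of @tuple_cons _ (space W) k]
  (mh (tensor_power W k.+1)) (h0 (tensor_power W k.+1))).
rewrite exprS EFinM -IH !EFin_hom_density.
rewrite -(ge0_integral_prodM _ _ (mh W) (mh (tensor_power W k)) (h0 W)
  (h0 (tensor_power W k))).
apply: eq_integral => x _; apply: eq_integral => u _.
rewrite -EFinM; congr (_%:E); rewrite /hom_fun -big_split.
apply: eq_bigr => p _; rewrite !tnth_mktuple /= /tensor_fun big_ord_recl.
by rewrite !tnth0; congr (_ * _); apply: eq_bigr => r _; rewrite !tnthS.
Qed.

End hom_function.

Lemma edge_density_tensor (R : realType) (W : symkernel R) k :
  edge_density (tensor_power W k) = edge_density W ^+ k.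
Proof.
apply: EFin_inj; rewrite EFin_expe !EFin_edge_density.
rewrite [LHS](ge0_integral_tensor_pair _ (fun=> measurable_ker W)).
  under eq_bigr do rewrite -EFin_edge_density.
  by rewrite prodEFin prodr_const card_ord EFin_expe EFin_edge_density.
by move=> _ z; case/andP: (ker_itv W z.1 z.2).
Qed.

Section restriction_integrals.
Context (R : realType) d (T : measurableType d) (P : probability T R).
Variables (S : set T) (mS : measurable S) (S0 : (0 < P S)%E).
Local Notation Q := (restr_prob mS S0).
Local Notation incl := (@restr_incl _ _ _ P S S0).
Local Notation c := ((fine (P S))^-1).
Local Open Scope ereal_scope.

Lemma fine_prob_gt0 : (0 < fine (P S))%R.
Proof. by rewrite fine_gt0// S0 ltey_eq fin_num_measure. Qed.

Lemma ge0_integral_restr (f : T -> \bar R) :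
  measurable_fun setT f -> (forall x, 0 <= f x) ->
  \int[Q]_y f (incl y) = c%:E * \int[P]_(x in S) f x.
Proof.
move=> mf f0; have mi : measurable_fun setT incl by move=> _ B mB; exists B.
have c0 : (0 <= c)%R by rewrite invr_ge0 fine_ge0.
rewrite (_ : setT = incl @^-1` S); last first.
  by apply/seteqP; split => // -[x xS] _ /=; exact: set_mem.
rewrite -(ge0_integral_pushforward mi Q) //; last first.
  exact: measurable_funS mf.
rewrite -[in RHS](ge0_integral_mscale P mS (NngNum c0)) //; last first.
  exact: measurable_funS mf.
apply: eq_measure_integral => A mA AS.
transitivity (@restr_measure _ _ _ P S S0 (incl @^-1` A)) => //.
by rewrite /restr_measure restr_incl_preimage setIidl// muleC.
Qed.

Lemma ge0_integral_restr_indic (f : T -> \bar R) :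
  measurable_fun setT f -> (forall x, 0 <= f x) ->
  \int[Q]_y f (incl y) = c%:E * \int[P]_x ((\1_S x)%:E * f x).
Proof.
move=> mf f0; rewrite ge0_integral_restr// integral_mkcond epatch_indic.
by congr (_ * _); apply: eq_integral => x _ /=; rewrite muleC.
Qed.

(** [J] marks the coordinates on which [F] depends.  Conditioning such a
    coordinate on [S] costs at most a factor 1 / P(S); conditioning any other
    coordinate changes nothing, which is how isolated vertices drop out of the
    exponent below. *)
Lemma ge0_integral_restr_le n (J : 'I_n -> bool) (F : n.-tuple T -> \bar R) :
    measurable_fun [set: n.-tuple T] F -> (forall x, 0 <= F x) ->
    (forall x x', (forall i, J i -> tnth x i = tnth x' i) -> F x = F x') ->
  \int[tuple_prob Q n]_y F (map_tuple incl y) <=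
  (c ^+ (\sum_(i < n) J i))%:E * \int[tuple_prob P n]_x F x.
Proof.
have mi : measurable_fun setT incl by move=> _ B mB; exists B.
have c0 : (0 <= c)%R by rewrite invr_ge0 fine_ge0.
have mmap m : measurable_fun [set: m.-tuple (restr_space S0)]
    (fun y : m.-tuple (restr_space S0) => map_tuple incl y).
  apply/measurable_fun_tnthP => i.
  rewrite (_ : _ \o _ = incl \o (@tnth _ _ ^~ i)).
    exact: (measurableT_comp mi (measurable_tnth i)).
  by apply/funext => y /=; rewrite tnth_map.
elim: n J F => [|n IH] J F mF F0 FJ.
  rewrite (ge0_integral_tuple0 _ (measurableT_comp mF (mmap 0%N))).
  rewrite (ge0_integral_tuple0 _ mF) big_ord0 expr0 mul1e.
  rewrite [leLHS](_ : _ = F [tuple])//.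
  by congr F; apply: eq_from_tnth => -[].
have mF2 : measurable_fun setT
    (fun z : T * n.-tuple T => F [tuple of z.1 :: z.2]).
  apply: (measurableT_comp mF).
  exact: (measurable_cons measurable_fst measurable_snd).
pose G t := \int[tuple_prob P n]_x F [tuple of t :: x].
have mG : measurable_fun setT G.
  exact: (measurable_ge0_integral (tuple_prob P n) mF2).
have G0 t : 0 <= G t by apply: integral_ge0.
pose J' i := J (lift ord0 i).
have mF3 := measurableT_comp mF (mmap n.+1).
have mF4 : measurable_fun setT
    (fun z : restr_space S0 * n.-tuple (restr_space S0) =>
    F (map_tuple incl [tuple of z.1 :: z.2])).
  apply: (measurableT_comp mF3).
  exact: (measurable_cons measurable_fst measurable_snd).
rewrite (ge0_integral_tupleS Q mF3); last by move=> x; exact: F0.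
rewrite (ge0_integral_tupleS P mF) //.
apply: (@le_trans _ _ (\int[Q]_y ((c ^+ (\sum_(i < n) J' i))%:E * G (incl y)))).
  apply: (ge0_le_integral Q measurableT).
  - by move=> y _; apply: integral_ge0 => x _; exact: F0.
  - exact: (measurable_ge0_integral (tuple_prob Q n) mF4).
  - apply: measurable_funeM; exact: (measurableT_comp mG mi).
  - move=> y _; have mFy := measurable_fun_pair2 (incl y) mF2.
    rewrite (_ : (fun y' : n.-tuple _ => F (map_tuple incl [tuple of y :: y'])) =
      (fun y' => F [tuple of incl y :: map_tuple incl y'])); last first.
      by apply/funext => y'; congr F; exact: val_inj.
    apply: (IH J' _ mFy (fun=> F0 _)) => x x' xx'; apply: FJ => i.
    case: (unliftP ord0 i) => [j ->|->] Ji; last by rewrite !tnth0.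
    by rewrite !tnthS; exact: xx'.
have cE m : 0 <= (c ^+ m)%:E by rewrite lee_fin exprn_ge0.
rewrite ge0_integralZl//; last exact: (measurableT_comp mG mi).
(* A marked coordinate pays the density of [restr_prob]; integrating out an
   unmarked one leaves the same constant on both sides. *)
rewrite big_ord_recl; case: (boolP (J ord0)) => [_|NJ0] /=.
  rewrite ge0_integral_restr// add1n exprSr EFinM -muleA.
  rewrite lee_wpmul2l// lee_wpmul2l ?lee_fin//.
  exact: ge0_subset_integral.
pose g := G point.
have Gg t : G t = g.
  apply: eq_integral => x _; apply: FJ => i.
  case: (unliftP ord0 i) => [j ->|->] Ji; first by rewrite !tnthS.
  by rewrite Ji in NJ0.
have int_g d' (X : measurableType d') (p : probability X R) h :
    (forall x, h x = g) -> \int[p]_x h x = g.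
  move=> hg; transitivity (\int[p]_x (cst g x)); first exact: eq_integral.
  by rewrite integral_cst// [X in _ * X]probability_setT mule1.
by rewrite add0n lee_wpmul2l// !int_g.
Qed.

End restriction_integrals.

Section restricted_densities.
Context (R : realType) (W : symkernel R).
Variables (S : set (space W)) (mS : measurable S) (S0 : (0 < prob W S)%E).
Local Notation c := ((fine (prob W S))^-1).

Lemma num_verticesE (H : graph) : num_vertices H =
  (\sum_(i < #|vertex H|) [exists v, adj (enum_val i) v])%N.
Proof.
rewrite /num_vertices -sum1_card big_mkcond /=.
rewrite (reindex_onto _ _ (fun x _ => enum_rankK x)) /=.
under eq_bigl do rewrite enum_valK eqxx.
apply: eq_bigr => i _; case: ifPn; rewrite ?notin_setE ?inE /=.
  by move=> ->.
by move=> /negP/negbTE ->.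
Qed.

Lemma hom_density_restriction H :
  hom_density (restriction mS S0) H <= c ^+ num_vertices H * hom_density W H.
Proof.
rewrite -lee_fin EFinM !EFin_hom_density num_verticesE.
apply: le_trans (@ge0_integral_restr_le _ _ _ (prob W) S mS S0 _
    (fun i => [exists v, adj (enum_val i) v]) (EFin \o @hom_fun _ H W) _ _ _).
- rewrite [leLHS](_ : _ = \int[tuple_prob (restr_prob mS S0) #|vertex H|]_y
    (hom_fun (map_tuple (@restr_incl _ _ _ _ _ S0) y))%:E)%E //.
  apply: eq_integral => y _; congr (_%:E).
  by apply: eq_bigr => p _; rewrite !tnth_map.
- by apply/measurable_EFinP; exact: measurable_hom_fun.
- by move=> x; rewrite lee_fin; case/andP: (hom_fun_itv x).
- move=> x x' xx' /=; congr (_%:E); apply: eq_bigr => p.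
  rewrite inE => /andP[pp _].
  by congr (W _ _); apply: xx'; apply/existsP; rewrite enum_rankK;
    [exists p.2|exists p.1; rewrite adj_sym].
Qed.

End restricted_densities.

(** * Weights between two sets of points *)

Section cut_weight.
Context (R : realType) (W : symkernel R).
Implicit Types A B : set (space W).

Definition cut_fun A B (z : space W * space W) : R :=
  \1_A z.1 * \1_B z.2 * W z.1 z.2.

Definition cut_weight A B : R := \int[(prob W \x prob W)%E]_z cut_fun A B z.

Lemma cut_fun_itv A B z : 0 <= cut_fun A B z <= 1.
Proof.
have /andP[W0 W1] := ker_itv W z.1 z.2; rewrite /cut_fun !indicE.
by do 2 case: (_ \in _);
  rewrite /= ?mulr1n ?mulr0n ?mul0r ?mul1r ?mulr0 ?mul0r ?lexx ?ler01 ?W0.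
Qed.

Lemma measurable_cut_fun A B : measurable A -> measurable B ->
  measurable_fun setT (cut_fun A B).
Proof.
have mi X : measurable X -> measurable_fun setT (\1_X : space W -> R).
  by move=> mX; exact: measurable_indic.
move=> mA mB; apply: measurable_funM; last exact: measurable_ker.
apply: measurable_funM.
  exact: (measurableT_comp (mi _ mA) measurable_fst).
exact: (measurableT_comp (mi _ mB) measurable_snd).
Qed.

Lemma EFin_cut_weight A B : measurable A -> measurable B ->
  ((cut_weight A B)%:E = \int[(prob W \x prob W)]_z (cut_fun A B z)%:E)%E.
Proof.
move=> mA mB; apply: EFin_Rintegral01; first exact: measurable_cut_fun.
exact: cut_fun_itv.
Qed.

Lemma le_cut_weight A B A' B' : measurable A -> measurable B ->
    measurable A' -> measurable B' -> A `<=` A' -> B `<=` B' ->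
  cut_weight A B <= cut_weight A' B'.
Proof.
move=> mA mB mA' mB' AA' BB'.
apply: le_Rintegral01; [exact: measurable_cut_fun|exact: measurable_cut_fun|
  exact: cut_fun_itv|exact: cut_fun_itv|move=> z].
have /andP[W0 _] := ker_itv W z.1 z.2.
have le1 X Y x : X `<=` Y -> (\1_X x : R) <= \1_Y x.
  move=> XY; rewrite !indicE ler_nat; case: (boolP (x \in X)) => // /set_mem Xx.
  by rewrite (mem_set (XY _ Xx)).
apply: ler_wpM2r => //; apply: ler_pM; rewrite ?indicE//; rewrite -!indicE;
  exact: le1.
Qed.

Lemma cut_weight_ge0 A B : 0 <= cut_weight A B.
Proof. by apply: Rintegral_ge0 => z _; case/andP: (cut_fun_itv A B z). Qed.

Lemma cut_weight_le_edge_density A B : measurable A -> measurable B ->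
  cut_weight A B <= edge_density W.
Proof.
move=> mA mB.
apply: (le_trans (le_cut_weight mA mB measurableT measurableT _ _)) => //.
rewrite le_eqVlt; apply/orP; left; apply/eqP; apply: eq_Rintegral => z _.
by rewrite /cut_fun !indicT !mul1r.
Qed.

Lemma cut_weightC A B : measurable A -> measurable B ->
  cut_weight A B = cut_weight B A.
Proof.
move=> mA mB; apply: EFin_inj; rewrite !EFin_cut_weight//.
have mAB := (measurable_EFinP _ _).2 (measurable_cut_fun mA mB).
have mBA := (measurable_EFinP _ _).2 (measurable_cut_fun mB mA).
have ge0 X Y z : (0 <= (EFin \o cut_fun X Y) z)%E.
  by rewrite lee_fin; case/andP: (cut_fun_itv X Y z).
rewrite (ge0_integral_prod _ _ mAB) // [RHS](fubini_tonelli2 _ mBA (ge0 _ _)).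
apply: eq_integral => x _; apply: eq_integral => y _.
by congr (_%:E); rewrite /cut_fun /= ker_sym [X in X * _]mulrC.
Qed.

Lemma cut_weight_le_measure A B : measurable A -> measurable B ->
  cut_weight A B <= fine (prob W A) * fine (prob W B).
Proof.
move=> mA mB; rewrite -lee_fin EFinM EFin_cut_weight//.
rewrite !fineK ?fin_num_measure//.
have mi X : measurable X -> measurable_fun setT (EFin \o (\1_X : space W -> R)).
  by move=> mX; apply/measurable_EFinP; exact: measurable_indic.
have i0 (X : set (space W)) x : (0 <= (EFin \o (\1_X : space W -> R)) x)%E.
  by rewrite lee_fin indicE.
have intE X : measurable X -> (\int[prob W]_x (EFin \o \1_X) x = prob W X)%E.
  by move=> mX; rewrite integral_indic// setIT.
rewrite -(intE _ mA) -(intE _ mB).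
rewrite -(ge0_integral_prodM _ _ (mi _ mA) (mi _ mB) (i0 _) (i0 _)).
have mcut := (measurable_EFinP _ _).2 (measurable_cut_fun mA mB).
have cut0 x y : (0 <= (cut_fun A B (x, y))%:E)%E.
  by rewrite lee_fin; case/andP: (cut_fun_itv A B (x, y)).
have mAB : measurable_fun setT (fun z : space W * space W =>
    (EFin \o \1_A) z.1 * (EFin \o \1_B) z.2 : \bar R)%E.
  apply: emeasurable_funM.
    exact: (measurableT_comp (mi _ mA) measurable_fst).
  exact: (measurableT_comp (mi _ mB) measurable_snd).
rewrite -(ge0_integral_prod (prob W) (prob W) mAB); last first.
  by move=> x y; exact: mule_ge0.
apply: ge0_le_integral => //; first by case=> x y _; exact: cut0.
move=> z _; rewrite lee_fin /cut_fun ler_piMr//.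
by case/andP: (ker_itv W z.1 z.2).
Qed.

Lemma edge_density_restriction (S : set (space W)) (mS : measurable S)
    (S0 : (0 < prob W S)%E) :
  edge_density (restriction mS S0) = (fine (prob W S))^-1 ^+ 2 * cut_weight S S.
Proof.
apply: EFin_inj; rewrite EFinM EFin_cut_weight// EFin_edge_density.
have mW : measurable_fun setT (fun z : space W * space W => (W z.1 z.2)%:E).
  by apply/measurable_EFinP; exact: measurable_ker.
have W0 x y : (0 <= (W x y)%:E)%E by rewrite lee_fin; case/andP: (ker_itv W x y).
have mcut := (measurable_EFinP _ _).2 (measurable_cut_fun mS mS).
have cut0 x y : (0 <= (cut_fun S S (x, y))%:E)%E.
  by rewrite lee_fin; case/andP: (cut_fun_itv S S (x, y)).
have mi : measurable_fun setT (EFin \o (\1_S : space W -> R)).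
  by apply/measurable_EFinP; exact: measurable_indic.
have i0 x : (0 <= (\1_S x : R)%:E)%E by rewrite lee_fin indicE.
have mSW : measurable_fun setT (fun z : space W * space W =>
    ((\1_S z.2)%:E * (W z.1 z.2)%:E : \bar R)%E).
  apply: emeasurable_funM; last exact: mW.
  exact: (measurableT_comp mi measurable_snd).
have SW0 x y : (0 <= (\1_S y)%:E * (W x y)%:E :> \bar R)%E by exact: mule_ge0.
rewrite (ge0_integral_prod _ _ mcut)//.
have c0 : (0 <= (fine (prob W S))^-1%:E)%E by rewrite lee_fin invr_ge0 fine_ge0.
have mWr : measurable_fun setT
    (fun z : space (restriction mS S0) * space (restriction mS S0) =>
       (restriction mS S0 z.1 z.2)%:E).
  by apply/measurable_EFinP; exact: measurable_ker.
rewrite (ge0_integral_prod _ _ mWr); last first.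
  by move=> x y; rewrite lee_fin; case/andP: (ker_itv W (restr_incl x)
    (restr_incl y)).
pose h x := ((fine (prob W S))^-1%:E *
  \int[prob W]_x' ((\1_S x')%:E * (W x x')%:E))%E.
have mint := measurable_ge0_integral (prob W) mSW SW0.
have mh : measurable_fun setT h by exact: measurable_funeM.
have h0 x : (0 <= h x)%E by apply: mule_ge0 => //; exact: integral_ge0.
transitivity (\int[restr_prob mS S0]_y h (restr_incl y))%E.
  apply: eq_integral => y _.
  by rewrite /h -(ge0_integral_restr_indic mS S0
    (measurable_fun_pair2 (restr_incl y) mW)).
rewrite (ge0_integral_restr_indic mS S0 mh h0).
rewrite expr2 EFinM -muleA; congr (_ * _)%E.
have mcut1 := measurable_ge0_integral (prob W) mcut cut0.
rewrite -(ge0_integralZl _ measurableT mcut1) //; last first.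
  by move=> x _; apply: integral_ge0 => y _; exact: cut0.
apply: eq_integral => x _; rewrite muleCA; congr (_ * _)%E.
rewrite -ge0_integralZl//; last exact: (measurable_fun_pair2 x mSW).
by apply: eq_integral => y _; rewrite -!EFinM /cut_fun /= mulrA.
Qed.

End cut_weight.

Section boxes.
Context (R : realType) d (T : measurableType d) (P : probability T R) (k : nat).
Implicit Types A : 'I_k -> set T.

Definition box A : set (k.-tuple T) := [set x | forall r, A r (tnth x r)].

Lemma measurable_box A : (forall r, measurable (A r)) -> measurable (box A).
Proof.
move=> mA; rewrite (_ : box A =
    \bigcap_(r in [set: 'I_k]) ((@tnth _ _ ^~ r) @^-1` A r)); last first.
  by apply/seteqP; split => x /= xA r; [move=> _|]; exact: xA.
apply: fin_bigcap_measurable => // r _; rewrite -[X in measurable X]setTI.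
exact: (measurable_tnth r).
Qed.

Lemma indic_box A x :
  \1_(box A) x = \prod_(r < k) \1_(A r) (tnth x r) :> R.
Proof.
rewrite indicE; case: (boolP (x \in box A)) => [/set_mem xA|xA].
  by rewrite big1// => r _; rewrite indicE mem_set.
have [r xr] : exists r, tnth x r \notin A r.
  apply/not_existsP => xA'; move/negP: xA; apply; apply/mem_set => r.
  by apply/set_mem; apply: contra_notT (xA' r).
by rewrite (bigD1 r) //= indicE (negbTE xr) mul0r.
Qed.

Lemma tuple_prob_box A : (forall r, measurable (A r)) ->
  fine (tuple_prob P k (box A)) = \prod_(r < k) fine (P (A r)).
Proof.
move=> mA; apply: EFin_inj.
rewrite -prodEFin fineK ?fin_num_measure//; last exact: measurable_box.
rewrite -[LHS](_ : \int[tuple_prob P k]_x (\1_(box A) x)%:E = _)%E; last first.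
  by rewrite integral_indic ?setIT//; exact: measurable_box.
under eq_integral do rewrite indic_box.
have mi r : measurable_fun setT (\1_(A r) : T -> R).
  exact: measurable_indic.
rewrite [LHS](ge0_integral_tensor P mi); last by move=> r x; rewrite indicE.
apply: eq_bigr => r _.
by rewrite integral_indic ?setIT// fineK ?fin_num_measure.
Qed.

End boxes.

Lemma cut_weight_tensor_box (R : realType) (W : symkernel R) k
    (A B : 'I_k -> set (space W)) :
    (forall r, measurable (A r)) -> (forall r, measurable (B r)) ->
  cut_weight (W := tensor_power W k) (box A) (box B) =
  \prod_(r < k) cut_weight (A r) (B r).
Proof.
move=> mA mB; apply: EFin_inj.
rewrite -prodEFin EFin_cut_weight; last 2 first.
- exact: measurable_box.
- exact: measurable_box.
under eq_bigr do rewrite EFin_cut_weight//.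
have mc r := measurable_cut_fun (mA r) (mB r).
rewrite -(ge0_integral_tensor_pair _ mc); last first.
  by move=> r z; case/andP: (cut_fun_itv (A r) (B r) z).
apply: eq_integral => z _; congr (_%:E).
by rewrite /cut_fun !indic_box /= /tensor_fun -!big_split.
Qed.

(** A heavy pair [A], [B] gives a heavy single set in the square of the
    kernel: the boxes A x B and B x A have the same measure, and the weight
    between them is that of [A], [B] times that of [B], [A].  The factor 2 comes
    from taking the union of the two boxes. *)
Lemma exists_swap_set (R : realType) (W : symkernel R) (A B : set (space W)) :
    measurable A -> measurable B -> 0 < cut_weight A B ->
  exists (S : set (space (tensor_power W 2))),
    [/\ measurable S, (0 < prob (tensor_power W 2) S)%E,
     fine (prob (tensor_power W 2) S) <=
       2 * (fine (prob W A) * fine (prob W B)) &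
     cut_weight A B ^+ 2 <= cut_weight S S].
Proof.
move=> mA mB AB0.
pose AB (r : 'I_2) := if r == ord0 then A else B.
pose BA (r : 'I_2) := if r == ord0 then B else A.
have mAB r : measurable (AB r) by rewrite /AB; case: ifP.
have mBA r : measurable (BA r) by rewrite /BA; case: ifP.
have mbAB := measurable_box mAB; have mbBA := measurable_box mBA.
pose a := fine (prob W A); pose b := fine (prob W B).
have ab0 : 0 < a * b by exact: lt_le_trans AB0 (cut_weight_le_measure mA mB).
have prAB : fine (tuple_prob (prob W) 2 (box AB)) = a * b.
  by rewrite tuple_prob_box// !big_ord_recl big_ord0 mulr1.
have prBA : fine (tuple_prob (prob W) 2 (box BA)) = a * b.
  by rewrite tuple_prob_box// !big_ord_recl big_ord0 mulr1 mulrC.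
have mS : measurable (box AB `|` box BA) by exact: measurableU.
exists (box AB `|` box BA); split => //.
- apply: (@lt_le_trans _ _ (tuple_prob (prob W) 2 (box AB))).
    by rewrite -[ltRHS]fineK ?fin_num_measure// prAB lte_fin.
  by apply: le_measure; rewrite ?inE.
- rewrite -lee_fin fineK ?fin_num_measure//.
  apply: (le_trans (measureU2 _ mbAB mbBA)).
  rewrite -[X in (X + _)%E]fineK ?fin_num_measure// prAB.
  rewrite -[X in (_ + X)%E]fineK ?fin_num_measure// prBA.
  by rewrite -EFinD lee_fin mulr2n mulrDl mul1r.
- apply: (@le_trans _ _ (cut_weight (W := tensor_power W 2) (box AB) (box BA))).
    rewrite cut_weight_tensor_box// !big_ord_recl big_ord0 mulr1.
    by rewrite /AB /BA /= (cut_weightC mB mA).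
  by apply: le_cut_weight.
Qed.

Lemma hom_density_ge0 (R : realType) (W : symkernel R) H :
  0 <= hom_density W H.
Proof.
by apply: Rintegral_ge0 => x _; case/andP: (@hom_fun_itv R H W x).
Qed.

(** The Sidorenko inequality for the square of [W] restricted to the set of
    [exists_swap_set].  The exponent of the measures is nonnegative, so an upper
    bound on the measure of that set suffices. *)
Lemma cut_weight_le_hom_density (R : realType) (C : symkernel R -> Prop)
    (H : graph) (W : symkernel R) (A B : set (space W)) :
    admissible C -> Sidorenko C H -> (num_vertices H <= 2 * num_edges H)%N ->
    C W -> measurable A -> measurable B -> 0 < cut_weight A B ->
  cut_weight A B ^+ (2 * num_edges H) <=
    (2 * (fine (prob W A) * fine (prob W B))) ^+
      (2 * num_edges H - num_vertices H) * hom_density W H ^+ 2.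
Proof.
move=> admC sidC ve CW mA mB AB0.
have [S [mS S0 Sle cutS]] := exists_swap_set mA mB AB0.
have CW2 := admissible_tensor admC CW (isT : (1 <= 2)%N).
have := sidC _ (admissible_restriction admC mS S0 CW2).
move=> /le_trans /(_ (hom_density_restriction mS S0 H)).
rewrite edge_density_restriction hom_density_tensor.
have s0 := fine_prob_gt0 mS S0.
set s := fine _ in s0 Sle *; set v := num_vertices H in ve *.
set e := num_edges H in ve *; set t := hom_density W H.
move=> le1; have le2 : cut_weight A B ^+ (2 * e) <= s ^+ (2 * e - v) * t ^+ 2.
  rewrite -(ler_pM2l (_ : 0 < s^-1 ^+ (2 * e))) ?exprn_gt0 ?invr_gt0//.
  rewrite [leRHS](_ : _ = s^-1 ^+ v * t ^+ 2); last first.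
    rewrite mulrA; congr (_ * _); rewrite -{1}(subnK ve) exprD mulrAC -exprMn.
    by rewrite mulVf ?expr1n ?mul1r// gt_eqF.
  apply: le_trans le1; rewrite exprMn -!exprM ler_pM2l ?exprn_gt0 ?invr_gt0//.
  by rewrite exprM lerXn2r// nnegrE ?exprn_ge0 ?cut_weight_ge0.
apply: (le_trans le2); rewrite ler_wpM2r ?exprn_ge0 ?hom_density_ge0//.
by rewrite lerXn2r// nnegrE ?(ltW s0)// (le_trans (ltW s0)).
Qed.

(** * Cutting a pair of simple functions into level sets *)

Section level_sets.
Context (R : realType) (W : symkernel R) (f h : space W -> R) (s : seq R).
Hypotheses (mf : measurable_fun setT f) (mh : measurable_fun setT h).
Hypotheses (f0 : forall x, 0 <= f x) (h0 : forall x, 0 <= h x).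
Hypotheses (fs : forall x, f x \in s) (hs : forall x, h x \in s).

Let level (g : space W -> R) a : set (space W) := g @^-1` [set a].

Let mlevel g a : measurable_fun setT g -> measurable (level g a).
Proof. by move=> mg; rewrite -[X in measurable X]setTI; exact: mg. Qed.

Let int_level g a : measurable_fun setT g ->
  ((a ^+ 2 * fine (prob W (level g a)))%:E <=
   \int[prob W]_x (g x ^+ 2)%:E)%E.
Proof.
move=> mg; have ml := mlevel a mg.
rewrite EFinM fineK ?fin_num_measure//.
rewrite -(_ : \int[prob W]_x (\1_(level g a) x)%:E = prob W (level g a))%E;
  last by rewrite integral_indic// setIT.
rewrite -ge0_integralZl//; last 2 first.
- by apply/measurable_EFinP; exact: measurable_indic.
- by rewrite lee_fin sqr_ge0.
apply: ge0_le_integral => //.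
- by move=> x _; rewrite -EFinM lee_fin mulr_ge0 ?sqr_ge0.
- apply/measurable_funeM/measurable_EFinP; exact: measurable_indic.
- by apply/measurable_EFinP; exact: measurable_funX.
- move=> x _; rewrite -EFinM lee_fin indicE.
  case: (boolP (x \in _)) => [/set_mem /= ->|_]; first by rewrite mulr1.
  by rewrite mulr0 sqr_ge0.
Qed.

(** Expanding [h] and [f] over their level sets bounds [K] by a sum of
    [size s ^ 2] terms, one of which is at least the average.  The level [a]
    of that term satisfies a ^ 2 * P(level) <= int of the square, which trades
    the heights of the two levels for the norms of [h] and [f]. *)
Lemma exists_level_sets (K F2 H2 l : R) :
    (K%:E = \int[(prob W \x prob W)]_z (h z.1 * W z.1 z.2 * f z.2)%:E)%E ->
    (F2%:E = \int[prob W]_x (f x ^+ 2)%:E)%E ->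
    (H2%:E = \int[prob W]_x (h x ^+ 2)%:E)%E ->
    0 < K -> l ^+ 2 * (H2 * F2) <= K ^+ 2 ->
  exists A B, [/\ measurable A, measurable B, 0 < cut_weight A B &
    l ^+ 2 * (fine (prob W A) * fine (prob W B)) <=
      (size s ^ 2)%:R ^+ 2 * cut_weight A B ^+ 2].
Proof.
move=> KE F2E H2E K0 lK.
pose q := [seq (a, b) | a <- s, b <- s].
(* [s] may contain values that are not attained, possibly negative ones; the
   absolute value keeps every term of the sum nonnegative. *)
pose u (p : R * R) := `|p.1 * p.2| * cut_weight (level h p.1) (level f p.2).
have szq : size q = (size s ^ 2)%N by rewrite size_allpairs mulnn.
have mlh a := mlevel a mh; have mlf a := mlevel a mf.
have mcut p := (measurable_EFinP _ _).2 (measurable_cut_fun (mlh p.1) (mlf p.2)).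
have cut0 A B z : 0 <= cut_fun (W := W) A B z by case/andP: (cut_fun_itv A B z).
have mK : measurable_fun setT
    (fun z : space W * space W => h z.1 * W z.1 z.2 * f z.2).
  apply: measurable_funM; last exact: (measurableT_comp mf measurable_snd).
  apply: measurable_funM; last exact: measurable_ker.
  exact: (measurableT_comp mh measurable_fst).
have W0 x y : 0 <= W x y by case/andP: (ker_itv W x y).
have Ksum : K <= \sum_(p <- q) u p.
  rewrite -lee_fin KE -sumEFin.
  under eq_bigr => p _.
    rewrite EFinM EFin_cut_weight// -ge0_integralZl//; last 2 first.
    - exact: mcut.
    - by move=> z _; rewrite lee_fin.
    over.
  rewrite -ge0_integral_sum//; last 2 first.
  - by move=> p; apply: measurable_funeM; exact: mcut.
  - by move=> p z _; rewrite -EFinM lee_fin mulr_ge0.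
  apply: ge0_le_integral => //.
  - by move=> z _; rewrite lee_fin !mulr_ge0.
  - exact/measurable_EFinP.
  - by apply: emeasurable_sum => p; apply: measurable_funeM; exact: mcut.
  - move=> z _; under eq_bigr do rewrite -EFinM.
    rewrite sumEFin lee_fin.
    have zq : (h z.1, f z.2) \in q by apply: allpairs_f.
    rewrite (big_rem _ zq) /= {1}/cut_fun !indicE !mem_set// !mul1r.
    rewrite ger0_norm ?mulr_ge0// mulrAC lerDl.
    by apply: sumr_ge0 => p _; rewrite mulr_ge0.
have [p Kp] : exists p, K <= (size s ^ 2)%:R * u p.
  apply/not_existsP => uK.
  have N0 : (0 < size q)%N.
    by case: (q) Ksum => //; rewrite big_nil leNgt K0.
  have : \sum_(p <- q) ((size s ^ 2)%:R * u p) < \sum_(p <- q) K.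
    apply: ltr_sum => [|p _]; first by rewrite has_predT.
    by rewrite ltNge; apply/negP; exact: uK.
  rewrite -mulr_sumr [ltRHS]big_const_seq count_predT iter_addr_0.
  rewrite -[K *+ _]mulr_natl szq.
  by rewrite -szq ltr_pM2l ?ltr0n// ltNge Ksum.
exists (level h p.1), (level f p.2).
set N := (size s ^ 2)%:R in Kp *; set w := cut_weight _ _.
have uw : u p = `|p.1 * p.2| * w by [].
have Nabw0 : 0 < N * (`|p.1 * p.2| * w) by rewrite -uw (lt_le_trans K0).
have N0 : 0 <= N by rewrite ler0n.
have w0 : 0 <= w by exact: cut_weight_ge0.
have ab0 : 0 < `|p.1 * p.2|.
  rewrite lt0r normr_ge0 andbT; apply: contraTneq Nabw0 => ->.
  by rewrite mul0r mulr0 ltxx.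
split => //.
  rewrite lt0r w0 andbT; apply: contraTneq Nabw0 => ->.
  by rewrite !mulr0 ltxx.
have ab2 : 0 < p.1 ^+ 2 * p.2 ^+ 2.
  by rewrite -exprMn -real_normK ?num_real// exprn_gt0.
rewrite -(ler_pM2l ab2).
have H2le := int_level p.1 mh; rewrite -H2E lee_fin in H2le.
have F2le := int_level p.2 mf; rewrite -F2E lee_fin in F2le.
have m0 (X : set (space W)) : 0 <= fine (prob W X) by rewrite fine_ge0.
apply: (@le_trans _ _ (l ^+ 2 * (H2 * F2))).
  rewrite [leLHS](_ : _ = l ^+ 2 *
    ((p.1 ^+ 2 * fine (prob W (level h p.1))) *
     (p.2 ^+ 2 * fine (prob W (level f p.2))))); last by ring.
  apply: ler_wpM2l; first exact: sqr_ge0.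
  by apply: ler_pM => //; apply: mulr_ge0 => //; exact: sqr_ge0.
apply: (le_trans lK).
rewrite [leRHS](_ : _ = (N * (`|p.1 * p.2| * w)) ^+ 2); last first.
  by rewrite !exprMn real_normK ?num_real// exprMn; ring.
by rewrite -uw lerXn2r// nnegrE ltW// (lt_le_trans K0).
Qed.

End level_sets.

(** * Tensor powers of a pair of simple functions *)

Lemma bernoulli_le (R : realFieldType) (x : R) n :
  0 <= x -> 1 + n%:R * x <= (1 + x) ^+ n.
Proof.
move=> x0; elim: n => [|n IH]; first by rewrite mul0r addr0 expr0.
rewrite exprS; apply: (@le_trans _ _ ((1 + x) * (1 + n%:R * x))).
  have : 0 <= n%:R * x * x by rewrite !mulr_ge0.
  by rewrite -natr1; nra.
by rewrite ler_wpM2l// addr_ge0.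
Qed.

(** Polynomial factors disappear in the limit of [k]-th roots.  Elementary form:
    otherwise [x / y = 1 + dl] with [dl > 0], and along [k = j * D.+1] Bernoulli
    gives a lower bound of degree [D.+1] in [j] against an upper bound of
    degree [D]. *)
Lemma le_of_exprn_le_poly (R : realType) (x y c : R) D :
    0 <= x -> 0 <= y -> 0 <= c ->
    (forall k, (0 < k)%N -> x ^+ k <= c * k.+1%:R ^+ D * y ^+ k) ->
  x <= y.
Proof.
move=> x0 y0 c0 xy; rewrite leNgt; apply/negP => yx.
have [y_eq0|yN0] := eqVneq y 0.
  have := xy 1%N isT; rewrite y_eq0 expr1 mulr0 => x_le0.
  by move: yx; rewrite y_eq0 ltNge x_le0.
have yp : 0 < y by rewrite lt0r yN0.
pose r := x / y; pose dl := r - 1.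
have dl0 : 0 < dl by rewrite subr_gt0 ltr_pdivlMr// mul1r.
have rE : r = 1 + dl by rewrite addrC subrK.
have rk k : (0 < k)%N -> r ^+ k <= c * k.+1%:R ^+ D.
  by move=> k0; rewrite expr_div_n ler_pdivrMr ?exprn_gt0//; exact: xy.
pose M := c * D.+2%:R ^+ D / dl ^+ D.+1.
have M0 : 0 <= M by rewrite divr_ge0 ?mulr_ge0 ?exprn_ge0// ltW.
pose j := (Num.trunc M).+1.
have jM : M < j%:R by exact: truncnS_gt.
have j0 : 0 < j%:R :> R by rewrite ltr0n.
have := rk (j * D.+1)%N (isT : (0 < j * D.+1)%N).
apply/negP; rewrite -ltNge.
apply: (@le_lt_trans _ _ (c * (j%:R * D.+2%:R) ^+ D)).
  apply: ler_wpM2l => //; rewrite lerXn2r ?nnegrE ?mulr_ge0//.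
  by rewrite -natrM ler_nat [leqRHS]mulnS -add1n leq_add2r.
apply: (@lt_le_trans _ _ ((j%:R * dl) ^+ D.+1)).
  rewrite exprMn [ltRHS]exprMn mulrCA exprSr -mulrA ltr_pM2l ?exprn_gt0//.
  by rewrite -ltr_pdivrMr ?exprn_gt0.
rewrite exprM lerXn2r ?nnegrE ?mulr_ge0 ?(ltW dl0) ?exprn_ge0//.
  by rewrite rE addr_ge0// ltW.
rewrite rE; apply: le_trans (bernoulli_le _ (ltW dl0)).
by rewrite lerDr.
Qed.

(** A product of [k] elements of [s] depends only on how often each element
    occurs: there are at most [k.+1] choices for each multiplicity, hence
    polynomially many products. *)
Lemma finite_range_prod (R : comNzRingType) (s : seq R) k :
  exists2 sk : seq R, (size sk <= k.+1 ^ size s)%N &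
    forall x : 'I_k -> R, (forall r, x r \in s) -> \prod_(r < k) x r \in sk.
Proof.
pose mon (c : {ffun 'I_(size s) -> 'I_k.+1}) :=
    \prod_(i < size s) s`_i ^+ c i.
exists [seq mon c | c : {ffun 'I_(size s) -> 'I_k.+1}].
  by rewrite size_map -cardE card_ffun !card_ord.
move=> x xs.
have ltx r : (index (x r) s < size s)%N by rewrite index_mem.
pose ix r := Ordinal (ltx r).
have card_lt (i : 'I_(size s)) : (#|[set r | ix r == i]%SET| < k.+1)%N.
  by rewrite ltnS -[leqRHS]card_ord max_card.
apply/mapP; exists [ffun i => Ordinal (card_lt i)]; first by rewrite mem_enum.
rewrite /mon (partition_big ix xpredT) //=; apply: eq_bigr => i _.
rewrite ffunE /= -prodr_const.
apply: eq_big => [r|r /eqP <-]; first by rewrite inE.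
by rewrite /= nth_index.
Qed.

Lemma double_subn (a b : nat) : (a <= b)%N ->
  (2 * (2 * b - a) = (b - a) * 2 + 2 * b)%N.
Proof. by lia. Qed.

Section simple_pair.
Context (R : realType) (C : symkernel R -> Prop) (H : graph) (W : symkernel R).
Variables (f h : space W -> R) (s : seq R) (K F2 H2 l : R).
Hypotheses (admC : admissible C) (sidC : Sidorenko C H) (CW : C W).
Hypothesis hH : (num_vertices H <= num_edges H)%N.
Hypotheses (mf : measurable_fun setT f) (mh : measurable_fun setT h).
Hypotheses (f0 : forall x, 0 <= f x) (h0 : forall x, 0 <= h x).
Hypotheses (fs : forall x, f x \in s) (hs : forall x, h x \in s).
Hypothesis KE :
  (K%:E = \int[(prob W \x prob W)]_z (h z.1 * W z.1 z.2 * f z.2)%:E)%E.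
Hypothesis F2E : (F2%:E = \int[prob W]_x (f x ^+ 2)%:E)%E.
Hypothesis H2E : (H2%:E = \int[prob W]_x (h x ^+ 2)%:E)%E.
Hypotheses (K0 : 0 < K) (l0 : 0 <= l) (lK : l ^+ 2 * (H2 * F2) <= K ^+ 2).

Local Notation v := (num_vertices H).
Local Notation e := (num_edges H).
Local Notation p := (edge_density W).
Local Notation t := (hom_density W H).

Let tens k (g : space W -> R) (x : space (tensor_power W k)) : R :=
  \prod_(r < k) g (tnth x r).

Let mtens k (g : space W -> R) :
  measurable_fun setT g -> measurable_fun setT (@tens k g).
Proof.
move=> mg; apply: measurable_prod => r _ /=.
exact: (measurableT_comp mg (measurable_tnth r)).
Qed.

Let tens0 k (g : space W -> R) :
  (forall x, 0 <= g x) -> forall x, 0 <= @tens k g x.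
Proof. by move=> g0 x; apply: prodr_ge0. Qed.

Let tens_sqr k (g : space W -> R) (G2 : R) :
  measurable_fun setT g -> (forall x, 0 <= g x) ->
  (G2%:E = \int[prob W]_x (g x ^+ 2)%:E)%E ->
  ((G2 ^+ k)%:E = \int[prob (tensor_power W k)]_x (@tens k g x ^+ 2)%:E)%E.
Proof.
move=> mg g0 gE; have mg2 (r : 'I_k) : measurable_fun setT (fun x => g x ^+ 2).
  exact: measurable_funX.
under eq_integral do rewrite /tens -prodrXl.
rewrite [RHS](ge0_integral_tensor _ mg2); last by move=> _ x; exact: sqr_ge0.
by under eq_bigr do rewrite -gE; rewrite prodEFin prodr_const card_ord.
Qed.

Let tens_K k : ((K ^+ k)%:E =
  \int[(prob (tensor_power W k) \x prob (tensor_power W k))]_z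
    (tens h z.1 * tensor_power W k z.1 z.2 * tens f z.2)%:E)%E.
Proof.
have mG (r : 'I_k) : measurable_fun setT
    (fun z : space W * space W => h z.1 * W z.1 z.2 * f z.2).
  apply: measurable_funM; last exact: (measurableT_comp mf measurable_snd).
  apply: measurable_funM; last exact: measurable_ker.
  exact: (measurableT_comp mh measurable_fst).
transitivity (\int[(tuple_prob (prob W) k \x tuple_prob (prob W) k)]_z
    (\prod_(r < k) (h (tnth z.1 r) * W (tnth z.1 r) (tnth z.2 r) *
       f (tnth z.2 r)))%:E)%E; last first.
  by apply: eq_integral => z _; rewrite /tens !big_split.
rewrite [RHS](ge0_integral_tensor_pair _ mG); last first.
  by move=> _ z; rewrite !mulr_ge0//; case/andP: (ker_itv W z.1 z.2).
by under eq_bigr do rewrite -KE; rewrite prodEFin prodr_const card_ord.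
Qed.

(** The level sets [A], [B] of the tensor powers of [h] and [f] have measures
    [a], [b] and weight [w] with l ^ (2k) * a * b <= N ^ 2 * w ^ 2 and
    w ^ (2e) <= (2 a b) ^ m * t ^ (2k), where [m = 2 * e - v].  Eliminating
    [a * b] leaves a nonnegative power of [w], which [w <= p ^+ k] bounds. *)
Lemma simple_pair_le : l ^+ (2 * e - v) <= p ^+ (e - v) * t.
Proof.
set m := (2 * e - v)%N.
have p0 : 0 <= p by apply: Rintegral_ge0 => z _; case/andP: (ker_itv W z.1 z.2).
have t0 : 0 <= t by exact: hom_density_ge0.
have lm0 : 0 <= l ^+ m by exact: exprn_ge0.
have ptm0 : 0 <= p ^+ (e - v) * t by rewrite mulr_ge0 ?exprn_ge0.
have ve2 : (v <= 2 * e)%N by rewrite mul2n -addnn (leq_trans hH) ?leq_addr.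
(* Squaring matches the even powers that the swapped boxes produce. *)
rewrite -(ler_pXn2r (n := 2)) ?nnegrE//.
suff main k : (0 < k)%N -> (l ^+ m) ^+ 2 ^+ k <=
    2 ^+ m * k.+1%:R ^+ (2 * size s * (2 * m)) * (p ^+ (e - v) * t) ^+ 2 ^+ k.
  by apply: (le_of_exprn_le_poly _ _ _ main); exact: exprn_ge0.
move=> k0.
have CU := admissible_tensor admC CW k0.
have [sk szk skP] := finite_range_prod s k.
have lKk : (l ^+ k) ^+ 2 * (H2 ^+ k * F2 ^+ k) <= (K ^+ k) ^+ 2.
  rewrite -!exprM ![(k * 2)%N]mulnC !exprM -!exprMn lerXn2r ?nnegrE//;
    last by rewrite exprn_ge0// ltW.
  rewrite mulr_ge0 ?sqr_ge0// mulr_ge0// -lee_fin ?H2E ?F2E;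
    by apply: integral_ge0 => x _; rewrite lee_fin sqr_ge0.
have tsk (g : space W -> R) : (forall x, g x \in s) ->
    forall x : space (tensor_power W k), tens g x \in sk.
  by move=> gs x; apply: skP => r; exact: gs.
have [A [B [mA mB AB0 lAB]]] := exists_level_sets (mtens mf) (mtens mh)
  (tens0 f0) (tens0 h0) (tsk _ fs) (tsk _ hs) (tens_K k)
  (tens_sqr k mf f0 F2E) (tens_sqr k mh h0 H2E) (exprn_gt0 k K0) lKk.
have := cut_weight_le_hom_density admC sidC ve2 CU mA mB AB0.
have wp := cut_weight_le_edge_density mA mB.
rewrite edge_density_tensor in wp; rewrite hom_density_tensor -/m.
set w := cut_weight A B in AB0 lAB wp *.
set ab := fine _ * fine _ in lAB *.
have ab0 : 0 <= ab by rewrite mulr_ge0 ?fine_ge0.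
set N := (size sk ^ 2)%:R in lAB.
(* [N] is the number of pairs of levels, polynomial in [k]. *)
have NM : N <= k.+1%:R ^+ (2 * size s).
  by rewrite /N -natrX ler_nat mulnC expnM leq_exp2r.
move=> wt; rewrite -(ler_pM2r (exprn_gt0 (2 * e) AB0)).
have lk0 : 0 <= (l ^+ k) ^+ 2 by rewrite sqr_ge0.
apply: (@le_trans _ _ ((2 * (N ^+ 2 * w ^+ 2)) ^+ m * (t ^+ k) ^+ 2)).
  rewrite [X in X * _](_ : _ = ((l ^+ k) ^+ 2) ^+ m); last first.
    by rewrite -!exprM; congr (_ ^+ _); rewrite mulnC mulnCA mulnA.
  apply: (le_trans (ler_wpM2l (exprn_ge0 m lk0) wt)).
  rewrite [leLHS](_ : _ = ((l ^+ k) ^+ 2 * (2 * ab)) ^+ m * (t ^+ k) ^+ 2);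
    last by rewrite [in RHS]exprMn mulrA.
  apply: ler_wpM2r; first exact: sqr_ge0.
  rewrite lerXn2r ?nnegrE//.
  - by apply: mulr_ge0 => //; exact: mulr_ge0.
  - by rewrite mulr_ge0// mulr_ge0 ?sqr_ge0.
  - by rewrite mulrCA ler_pM2l.
rewrite [leLHS](_ : _ =
    2 ^+ m * (N ^+ (2 * m) * ((w ^+ (e - v)) ^+ 2 * (t ^+ k) ^+ 2)) *
    w ^+ (2 * e)); last first.
  rewrite exprMn [(N ^+ 2 * _) ^+ m]exprMn -!exprM.
  have -> : w ^+ (2 * m) = w ^+ ((e - v) * 2) * w ^+ (2 * e).
    rewrite -exprD /m; congr (_ ^+ _).
    exact: double_subn.
  move: (2 ^+ m) (N ^+ _) (w ^+ (_ * 2)) (w ^+ (2 * e)) (t ^+ _).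
  by move=> ? ? ? ? ?; ring.
apply: ler_wpM2r; first by rewrite exprn_ge0 ?ltW.
rewrite -mulrA; apply: ler_wpM2l; first exact: exprn_ge0.
have w0 := ltW AB0; have N0 : 0 <= N by exact: ler0n.
apply: ler_pM; first exact: exprn_ge0.
- by rewrite mulr_ge0 ?sqr_ge0.
- by rewrite [leRHS]exprM lerXn2r ?nnegrE ?exprn_ge0.
rewrite -exprMn [leRHS](_ : _ = ((p ^+ k) ^+ (e - v) * t ^+ k) ^+ 2).
  rewrite lerXn2r ?nnegrE ?mulr_ge0 ?exprn_ge0//.
  by rewrite ler_wpM2r ?exprn_ge0// lerXn2r ?nnegrE ?exprn_ge0.
by rewrite -exprM mulnC exprM; congr (_ ^+ 2); rewrite exprMn -!exprM (mulnC k).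
Qed.

End simple_pair.

(** * The operator norm *)

Lemma L2normE (R : realType) (W : symkernel R) (f : space W -> R) :
  L2norm f = Num.sqrt (\int[prob W]_x (f x ^+ 2)).
Proof.
rewrite /L2norm unlock /= fine_poweR powR12_sqrt ?fine_ge0//; last first.
  by apply: integral_ge0 => x _; rewrite lee_fin powR_ge0.
congr (Num.sqrt (fine _)); apply: eq_integral => x _ /=.
by rewrite powR_mulrn// real_normK// num_real.
Qed.

Section kernel_operator.
Context (R : realType) (W : symkernel R).
Local Notation P := (prob W).
Local Notation p := (edge_density W).

Let W0 x y : 0 <= W x y. Proof. by case/andP: (ker_itv W x y). Qed.
Let W1 x y : W x y <= 1. Proof. by case/andP: (ker_itv W x y). Qed.

Section unit_ball.
Variable f : space W -> R.
Hypotheses (fL2 : f \in Lfun P 2%:E) (f1 : L2norm f <= 1).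

Lemma Lfun_measurable : measurable_fun setT f.
Proof. by move: fL2; rewrite inE => /andP[]; rewrite inE. Qed.
Local Notation mf := Lfun_measurable.

Lemma integral_sqr_le1 : (\int[P]_x (f x ^+ 2)%:E <= 1)%E.
Proof.
have /integrableP[mf2 _] := Lfun2_integrable_sqr fL2.
have ifin : (\int[P]_x (f x ^+ 2)%:E)%E \is a fin_num.
  exact: (integrable_fin_num _ (Lfun2_integrable_sqr fL2)).
move: f1; rewrite L2normE -[X in _ <= X]sqrtr1 ler_sqrt// => le1.
by rewrite -(fineK ifin) lee_fin.
Qed.

Let mabs : measurable_fun setT (fun x => `|f x|).
Proof. exact: measurableT_comp mf. Qed.

(** From the pointwise bound [2 * a <= 1 + a ^+ 2]. *)
Lemma integral_abs_le1 : (\int[P]_x `|f x|%:E <= 1)%E.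
Proof.
have mf2 : measurable_fun setT (fun x => f x ^+ 2) by exact: measurable_funX mf.
have half0 : 0 <= 2^-1 :> R by rewrite invr_ge0.
apply: (@le_trans _ _ (\int[P]_x ((2^-1)%:E * (1 + (f x ^+ 2)%:E))))%E.
  apply: (ge0_le_integral P measurableT) => [x _|||x _].
  - by rewrite lee_fin.
  - exact/measurable_EFinP.
  - apply/measurable_funeM/emeasurable_funD => //; exact/measurable_EFinP.
  - rewrite -EFinD -EFinM lee_fin ler_pdivlMl//.
    have := sqr_ge0 (`|f x| - 1); rewrite sqrrB1 real_normK ?num_real//.
    by rewrite addrAC subr_ge0 mulr_natl addrC.
rewrite ge0_integralZl//; last 2 first.
- apply/emeasurable_funD => //; exact/measurable_EFinP.
- by move=> x _; rewrite adde_ge0// lee_fin sqr_ge0.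
rewrite ge0_integralD//; last 2 first.
- by move=> x _; rewrite lee_fin sqr_ge0.
- exact/measurable_EFinP.
rewrite integral_cst// [X in (_ * (_ * X + _))%E]probability_setT mule1.
apply: (@le_trans _ _ ((2^-1)%:E * (1 + 1)))%E.
  by rewrite lee_wpmul2l// leeD2l// integral_sqr_le1.
by rewrite -EFinD -EFinM lee_fin mulVf.
Qed.

(** The kernel operator applied to [`|f|]: it dominates [`|kernel_op f|], and
    unlike [kernel_op f] it is an integral of a nonnegative function. *)
Definition abs_op x : R := \int[P]_y (W x y * `|f y|).

Let mWabs : measurable_fun setT
  (fun z : space W * space W => (W z.1 z.2 * `|f z.2|)%:E).
Proof.
apply/measurable_EFinP/measurable_funM; first exact: measurable_ker.
exact: (measurableT_comp mabs measurable_snd).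
Qed.

Let Wabs0 x y : (0 <= (W x y * `|f y|)%:E)%E.
Proof. by rewrite lee_fin mulr_ge0. Qed.

Let int_le1 x : (\int[P]_y (W x y * `|f y|)%:E <= 1)%E.
Proof.
apply: le_trans integral_abs_le1.
apply: (ge0_le_integral P measurableT) => [y _|||y _] //.
- exact: (measurable_fun_pair2 x mWabs).
- exact/measurable_EFinP.
- by rewrite lee_fin ler_piMl.
Qed.

Lemma EFin_abs_op x : ((abs_op x)%:E = \int[P]_y (W x y * `|f y|)%:E)%E.
Proof.
rewrite fineK// ge0_fin_numE; last by apply: integral_ge0.
exact: le_lt_trans (int_le1 x) (ltry _).
Qed.

Lemma abs_op_itv x : 0 <= abs_op x <= 1.
Proof. by rewrite -!lee_fin EFin_abs_op int_le1 integral_ge0. Qed.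

Lemma measurable_abs_op : measurable_fun setT abs_op.
Proof.
apply/measurable_EFinP.
rewrite (_ : EFin \o _ = fun x => \int[P]_y (W x y * `|f y|)%:E)%E; last first.
  by apply/funext => x /=; rewrite EFin_abs_op.
exact: (measurable_ge0_integral P mWabs).
Qed.

Let mWf : measurable_fun setT
  (fun z : space W * space W => W z.1 z.2 * f z.2).
Proof.
apply: measurable_funM; first exact: measurable_ker.
exact: (measurableT_comp mf measurable_snd).
Qed.

Let normWf x y : `|W x y * f y| = W x y * `|f y|.
Proof. by rewrite normrM ger0_norm. Qed.

Lemma measurable_kernel_op : measurable_fun setT (kernel_op f).
Proof.
have iWf : (P \x P)%E.-integrable setT
    (EFin \o (fun z : space W * space W => W z.1 z.2 * f z.2)).
  apply/integrable12ltyP; first exact/measurable_EFinP.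
  apply: (@le_lt_trans _ _ (\int[P]_x (cst 1 x))%E); last first.
    by rewrite integral_cst// mul1e [ltLHS]probability_setT ltry.
  under eq_integral do under eq_integral do rewrite /= normWf.
  apply: (ge0_le_integral P measurableT) => [x _|||x _].
  - by apply: integral_ge0 => y _; exact: Wabs0.
  - exact: (measurable_ge0_integral P mWabs).
  - exact: measurable_cst.
  - exact: int_le1.
exact: (measurableT_comp (fine_measurable measurableT)
  (measurable_fubini_F iWf)).
Qed.

Lemma normr_kernel_op_le x : `|kernel_op f x| <= abs_op x.
Proof.
have iWf : P.-integrable setT (EFin \o (fun y => W x y * f y)).
  apply/integrableP; split.
    by apply/measurable_EFinP; exact: (measurable_fun_pair2 x mWf).
  under eq_integral do rewrite /= normWf.
  exact: le_lt_trans (int_le1 x) (ltry _).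
apply: (le_trans (le_normr_Rintegral measurableT iWf)).
by rewrite le_eqVlt; apply/orP; left; apply/eqP/eq_Rintegral => y _.
Qed.

Let sqr_itv (g : space W -> R) : (forall x, `|g x| <= abs_op x) ->
  forall x, 0 <= g x ^+ 2 <= 1.
Proof.
move=> gle x; have /andP[_ le1] := abs_op_itv x.
rewrite sqr_ge0 -[leLHS]real_normK ?num_real// -[leRHS](expr1n _ 2).
by rewrite lerXn2r ?nnegrE// (le_trans (gle x)).
Qed.

Lemma L2norm_kernel_op_le :
  L2norm (kernel_op f) <= Num.sqrt (\int[P]_x (abs_op x ^+ 2)).
Proof.
have abs_abs x : `|abs_op x| <= abs_op x.
  by rewrite ger0_norm//; case/andP: (abs_op_itv x).
rewrite L2normE; apply: ler_wsqrtr; apply: le_Rintegral01.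
- exact: measurable_funX measurable_kernel_op.
- exact: measurable_funX measurable_abs_op.
- exact: sqr_itv normr_kernel_op_le.
- exact: sqr_itv abs_abs.
- move=> x; rewrite -[leLHS]real_normK ?num_real// lerXn2r ?nnegrE//.
    by case/andP: (abs_op_itv x).
  exact: normr_kernel_op_le.
Qed.

Lemma integral_abs_op_sqr_le1 : \int[P]_x (abs_op x ^+ 2) <= 1.
Proof.
have abs_abs x : `|abs_op x| <= abs_op x.
  by rewrite ger0_norm//; case/andP: (abs_op_itv x).
have <- : \int[P]_x (cst 1 x) = 1 :> R.
  by rewrite Rintegral_cst// mul1r [X in fine X]probability_setT.
apply: le_Rintegral01 => //.
- exact: measurable_funX measurable_abs_op.
- exact: sqr_itv abs_abs.
- by move=> x; rewrite /= ler01 lexx.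
- by move=> x; case/andP: (sqr_itv abs_abs x).
Qed.

Lemma L2norm_kernel_op_le1 : L2norm (kernel_op f) <= 1.
Proof.
apply: (le_trans L2norm_kernel_op_le); rewrite -[leRHS]sqrtr1.
exact/ler_wsqrtr/integral_abs_op_sqr_le1.
Qed.

Lemma EFin_abs_op_sqr :
  ((\int[P]_x (abs_op x ^+ 2))%:E = \int[P]_x (abs_op x ^+ 2)%:E)%E.
Proof.
apply: EFin_Rintegral01; first exact: measurable_funX measurable_abs_op.
by apply: sqr_itv => x; rewrite ger0_norm//; case/andP: (abs_op_itv x).
Qed.

End unit_ball.

Let cst_unit c : 0 <= c <= 1 ->
  (cst c : space W -> R) \in Lfun P 2%:E /\ L2norm (cst c : space W -> R) <= 1.
Proof.
move=> /andP[c0 c1]; split; first exact: Lfun_cst.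
rewrite L2normE (_ : (fun x => _) = cst (c ^+ 2))// Rintegral_cst//.
rewrite [X in fine X]probability_setT mulr1 sqrtr_sqr.
by rewrite ger0_norm.
Qed.

Lemma op_norm_set_nonempty : [set L2norm (kernel_op f) | f in
  [set f : space W -> R | f \in Lfun P 2%:E /\ L2norm f <= 1]] !=set0.
Proof.
by exists (L2norm (kernel_op (cst 0 : space W -> R))), (cst 0) => //;
  apply: cst_unit; rewrite lexx ler01.
Qed.

Lemma L2norm_kernel_op_le_op_norm f : f \in Lfun P 2%:E -> L2norm f <= 1 ->
  L2norm (kernel_op f) <= op_norm W.
Proof.
move=> fL2 f1; apply: sup_upper_bound; last by exists f.
split; first exact: op_norm_set_nonempty.
by exists 1 => _ [g [gL2 g1] <-]; exact: L2norm_kernel_op_le1.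
Qed.

(** The constant function 1 is a unit vector, and the norm of its image is at
    least the mean of its image. *)
Lemma edge_density_le_op_norm : p <= op_norm W.
Proof.
have [L1 N1] := cst_unit (introT andP (conj (@ler01 R) (lexx 1))).
apply: le_trans (L2norm_kernel_op_le_op_norm L1 N1).
have degE : kernel_op (cst 1 : space W -> R) = abs_op (cst 1).
  by apply/funext => x; apply: eq_Rintegral => y _; rewrite /= normr1.
rewrite L2normE degE.
set g := abs_op _; have p0 : 0 <= p by exact: Rintegral_ge0.
have mg : measurable_fun setT g by exact: measurable_abs_op.
have g01 x : 0 <= g x <= 1 by exact: abs_op_itv.
have pE : (p%:E = \int[P]_x (g x)%:E)%E.
  rewrite EFin_edge_density ge0_integral_prod//.
  - apply: eq_integral => x _; rewrite EFin_abs_op//.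
    by apply: eq_integral => y _; rewrite normr1 mulr1.
  - by apply/measurable_EFinP; exact: measurable_ker.
have mgE : measurable_fun setT (EFin \o g) by exact/measurable_EFinP.
rewrite -(ger0_norm p0) -sqrtr_sqr; apply: ler_wsqrtr.
(* [g] is the degree function, of mean [p]; integrating [(g x - p) ^+ 2 >= 0]
   gives the claim. *)
have : (\int[P]_x ((2 * p)%:E * (g x)%:E) <=
        \int[P]_x ((g x ^+ 2)%:E + (p ^+ 2)%:E))%E.
  apply: (ge0_le_integral P measurableT) => [x _|||x _].
  - by rewrite -EFinM lee_fin !mulr_ge0//; case/andP: (g01 x).
  - exact: measurable_funeM.
  - apply: emeasurable_funD => //; apply/measurable_EFinP.
    exact: measurable_funX.
  - rewrite -EFinM -EFinD lee_fin -subr_ge0.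
    rewrite (_ : _ - _ = (g x - p) ^+ 2); first exact: sqr_ge0.
    by ring.
rewrite ge0_integralZl//; last 2 first.
- by move=> x _; rewrite lee_fin; case/andP: (g01 x).
- by rewrite lee_fin mulr_ge0.
have mg2 : measurable_fun setT (fun x => (g x ^+ 2)%:E).
  by apply/measurable_EFinP; exact: measurable_funX.
rewrite (ge0_integralD _ measurableT _ mg2) //; last 2 first.
- by move=> x _; rewrite lee_fin sqr_ge0.
- by move=> x _; rewrite lee_fin sqr_ge0.
rewrite integral_cst// [X in (_ <= _ + _ * X)%E]probability_setT mule1.
rewrite -pE -EFin_abs_op_sqr// -/g -EFinM -EFinD lee_fin.
rewrite (_ : 2 * p * p = p ^+ 2 + p ^+ 2) ?lerD2r//.
by move: p => q; ring.
Qed.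

End kernel_operator.

(** * Comparison with the spectral bound *)

Section approximation.
Context (R : realType) (W : symkernel R).
Local Notation P := (prob W).
Import HBNNSimple.

Lemma nnsfun_finite_range (f : {nnsfun space W >-> R}) :
  exists s : seq R, forall x, f x \in s.
Proof.
have /finite_seqP[s rs] := fimfunP f; exists s => x.
by have : range f (f x); [exists x|rewrite rs].
Qed.

(** If [f] is in the unit ball and [l] is less than the norm of its image, replace
    [f] by [`|f|] and test against [h = abs_op f]: the form equals the squared
    norm [s2] of [h], which exceeds [l] times the norm of [h].  The inequality is
    strict, so it survives replacing both functions by simple functions that
    increase to them, while their norms can only decrease. *)
Lemma exists_simple_pair (l : R) : 0 <= l -> l < op_norm W ->
  exists f h : {nnsfun space W >-> R}, exists K F2 H2 : R,
    [/\ (K%:E = \int[(P \x P)]_z (h z.1 * W z.1 z.2 * f z.2)%:E)%E,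
        (F2%:E = \int[P]_x (f x ^+ 2)%:E)%E,
        (H2%:E = \int[P]_x (h x ^+ 2)%:E)%E,
        0 < K & l ^+ 2 * (H2 * F2) <= K ^+ 2].
Proof.
move=> l0 lt_l.
have [_ [f [fL2 f1] <-] ltf] := sup_gt (op_norm_set_nonempty W) lt_l.
pose g x := `|f x|; pose h := abs_op f.
have W0 x y : 0 <= W x y by case/andP: (ker_itv W x y).
have g0 x : 0 <= g x by exact: normr_ge0.
have h0 x : 0 <= h x by case/andP: (abs_op_itv fL2 f1 x).
have mg : measurable_fun setT g.
  exact: measurableT_comp (Lfun_measurable fL2).
have mh : measurable_fun setT h by exact: measurable_abs_op.
have mgE : measurable_fun setT (EFin \o g) by exact/measurable_EFinP.
have mhE : measurable_fun setT (EFin \o h) by exact/measurable_EFinP.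
pose s2 := \int[P]_x (h x ^+ 2).
have ls2 : l < Num.sqrt s2.
  exact: lt_le_trans ltf (L2norm_kernel_op_le fL2 f1).
have sq0 : 0 < Num.sqrt s2 by exact: le_lt_trans ls2.
have s20 : 0 < s2 by rewrite -sqrtr_gt0.
have s2E : (s2%:E = \int[P]_x (h x ^+ 2)%:E)%E by exact: EFin_abs_op_sqr.
pose G (u w : space W -> R) (z : space W * space W) :=
  u z.1 * W z.1 z.2 * w z.2.
have mG u w : measurable_fun setT u -> measurable_fun setT w ->
    measurable_fun setT (G u w).
  move=> mu mw; apply: measurable_funM.
    apply: measurable_funM; last exact: measurable_ker.
    exact: (measurableT_comp mu measurable_fst).
  exact: (measurableT_comp mw measurable_snd).
have intG : (\int[(P \x P)]_z (G h g z)%:E = s2%:E)%E.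
  rewrite ge0_integral_prod//.
  - rewrite s2E; apply: eq_integral => x _.
    transitivity (\int[P]_y ((h x)%:E * (W x y * `|f y|)%:E))%E.
      by apply: eq_integral => y _; rewrite -EFinM /G mulrA.
    have mWg : measurable_fun setT (fun y => (W x y * `|f y|)%:E).
      apply/measurable_EFinP/measurable_funM => //.
      exact: (measurable_fun_pair2 x (measurable_ker W)).
    rewrite (ge0_integralZl _ measurableT mWg) ?lee_fin//; last first.
      by move=> y _; rewrite lee_fin mulr_ge0.
    by rewrite -EFin_abs_op// -EFinM expr2.
  - by apply/measurable_EFinP; exact: mG.
  - by move=> x y; rewrite lee_fin !mulr_ge0.
pose f_ := nnsfun_approx measurableT mgE.
pose h_ := nnsfun_approx measurableT mhE.
(* Simple functions increase to [g] and [h]; the integrals of the form follow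
   by monotone convergence. *)
have cvg_real (u : (space W -> R)) (mu : measurable_fun setT (EFin \o u)) x :
    (forall x, 0 <= u x) ->
    nnsfun_approx measurableT mu n x @[n --> \oo] --> u x.
  move=> u0.
  have := @cvg_nnsfun_approx _ _ _ _ measurableT _ mu (fun x _ => u0 x) x I.
  by move=> /fine_cvg.
have nd_ (u : (space W -> R)) (mu : measurable_fun setT (EFin \o u)) x :
    nondecreasing_seq (fun n => nnsfun_approx measurableT mu n x).
  by move=> a b ab; exact/lefP/nd_nnsfun_approx.
have le_ (u : (space W -> R)) (mu : measurable_fun setT (EFin \o u)) n x :
    (forall x, 0 <= u x) -> nnsfun_approx measurableT mu n x <= u x.
  move=> u0; rewrite -(cvg_lim (@Rhausdorff R) (cvg_real u mu x u0)).
  apply: nondecreasing_cvgn_le; first exact: nd_.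
  by apply/cvg_ex; exists (u x); exact: cvg_real.
have cvgK : (\int[(P \x P)]_z (G (h_ n) (f_ n) z)%:E @[n --> \oo] --> s2%:E)%E.
  rewrite -intG.
  rewrite [X in _ --> X](_ : _ =
    \int[(P \x P)]_z limn (fun n => (G (h_ n) (f_ n) z)%:E))%E; last first.
    apply: eq_integral => z _; apply/esym/cvg_lim => //.
    apply/cvg_EFin; first exact: nearW.
    by apply: cvgM; [apply: cvgMl; exact: cvg_real|exact: cvg_real].
  apply: cvg_monotone_convergence => //.
  - by move=> n; apply/measurable_EFinP; exact: mG.
  - by move=> n z _; rewrite lee_fin !mulr_ge0.
  - move=> z _ a b ab; rewrite lee_fin /G.
    by rewrite ler_pM ?mulr_ge0// ?nd_// ler_pM// nd_.
have [n ltn] : exists n, ((l * Num.sqrt s2)%:E <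
    \int[(P \x P)]_z (G (h_ n) (f_ n) z)%:E)%E.
  apply/not_existsP => Kle.
  have : (s2%:E <= (l * Num.sqrt s2)%:E)%E.
    rewrite -(cvg_lim (@ereal_hausdorff R) cvgK); apply: lime_le.
      by apply/cvg_ex; exists s2%:E.
    by apply: nearW => n; rewrite leNgt; exact/negP/Kle.
  rewrite lee_fin leNgt -{2}(sqr_sqrtr (ltW s20)) expr2 ltr_pM2r//.
  by rewrite ls2.
have le_g x : f_ n x <= g x by exact: le_.
have le_h x : h_ n x <= h x by exact: le_.
have mGn : measurable_fun setT (G (h_ n) (f_ n)) by exact: mG.
have G0 u w z : (forall x, 0 <= u x) -> (forall x, 0 <= w x) -> 0 <= G u w z.
  by move=> u0 w0; rewrite !mulr_ge0.
have sqr_le (u w : space W -> R) x : (forall x, 0 <= u x) ->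
    (forall x, u x <= w x) -> u x ^+ 2 <= w x ^+ 2.
  by move=> u0 uw; rewrite lerXn2r ?nnegrE// (le_trans (u0 x)).
have fin (d : measure_display) (T : measurableType d)
    (Q : probability T R) (u w : T -> R) b :
    measurable_fun setT u -> measurable_fun setT w -> (forall x, 0 <= u x) ->
    (forall x, u x <= w x) -> (\int[Q]_x (w x)%:E <= b%:E)%E ->
    {r | (r%:E = \int[Q]_x (u x)%:E)%E & 0 <= r <= b}.
  move=> mu mw u0 uw wb.
  have ub : (\int[Q]_x (u x)%:E <= b%:E)%E.
    apply: le_trans wb; apply: (ge0_le_integral Q measurableT) => [x _|||x _].
    - by rewrite lee_fin.
    - exact/measurable_EFinP.
    - exact/measurable_EFinP.
    - by rewrite lee_fin.
  have i0 : (0 <= \int[Q]_x (u x)%:E)%E.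
    by apply: integral_ge0 => x _; rewrite lee_fin.
  have rE : ((fine (\int[Q]_x (u x)%:E))%:E = \int[Q]_x (u x)%:E)%E.
    by rewrite fineK// ge0_fin_numE// (le_lt_trans ub)// ltry.
  by exists (fine (\int[Q]_x (u x)%:E)%E) => //; rewrite -!lee_fin rE i0.
have [F2 F2E /andP[F20 F21]] : {r | (r%:E = \int[P]_x (f_ n x ^+ 2)%:E)%E &
    0 <= r <= 1}.
  apply: (fin _ _ P _ (fun x => g x ^+ 2)).
  - exact: measurable_funX.
  - exact: measurable_funX.
  - by move=> x; exact: sqr_ge0.
  - by move=> x; exact: sqr_le.
  - rewrite (_ : (fun x => _) = (fun x => (f x ^+ 2)%:E)).
      exact: integral_sqr_le1.
    by apply/funext => x; rewrite /g real_normK// num_real.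
have [H2 H2E /andP[H20 H21]] : {r | (r%:E = \int[P]_x (h_ n x ^+ 2)%:E)%E &
    0 <= r <= s2}.
  apply: (fin _ _ P _ (fun x => h x ^+ 2)).
  - exact: measurable_funX.
  - exact: measurable_funX.
  - by move=> x; exact: sqr_ge0.
  - by move=> x; exact: sqr_le.
  - by rewrite s2E.
have [K KE _] : {r | (r%:E = \int[(P \x P)]_z (G (h_ n) (f_ n) z)%:E)%E &
    0 <= r <= s2}.
  apply: (fin _ _ (P \x P)%E _ (G h g)).
  - exact: mGn.
  - exact: mG.
  - by move=> z; apply: G0.
  - by move=> z; rewrite /G ler_pM ?mulr_ge0// ler_pM.
  - by rewrite intG.
rewrite -KE lte_fin in ltn.
exists (f_ n), (h_ n), K, F2, H2; split => //.
  by apply: le_lt_trans ltn; rewrite mulr_ge0// ltW.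
apply: (@le_trans _ _ ((l * Num.sqrt s2) ^+ 2)).
  rewrite exprMn sqr_sqrtr ?(ltW s20)// ler_wpM2l ?sqr_ge0//.
  by rewrite -[leRHS]mulr1 ler_pM.
have ls0 : 0 <= l * Num.sqrt s2 by rewrite mulr_ge0// ltW.
by rewrite lerXn2r ?nnegrE// ?(le_trans ls0)// ltW.
Qed.

End approximation.

Lemma edge_density_gt0 (R : realType) (W : symkernel R) :
  nonzero W -> 0 < edge_density W.
Proof.
move=> nzW; have W0 z : 0 <= W z.1 z.2 by case/andP: (ker_itv W z.1 z.2).
rewrite lt0r Rintegral_ge0// andbT; apply/eqP => p0; apply: nzW.
have mW : measurable_fun setT (fun z : space W * space W => (W z.1 z.2)%:E).
  by apply/measurable_EFinP; exact: measurable_ker.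
have := EFin_edge_density W; rewrite p0 => /esym int0.
have : (\int[(prob W \x prob W)]_z `|(W z.1 z.2)%:E| = 0)%E.
  by rewrite -[RHS]int0; apply: eq_integral => z _; rewrite gee0_abs ?lee_fin.
move=> /(ae_eq_integral_abs _ measurableT mW).
by apply: filterS => z /(_ I) [].
Qed.

Lemma edge_density_eq0 (R : realType) (W : symkernel R) :
  ~ nonzero W -> edge_density W = 0.
Proof.
move=> /contrapT W0; apply: EFin_inj; rewrite EFin_edge_density.
rewrite (ae_eq_integral (cst 0%E)) ?integral0//.
  by apply/measurable_EFinP; exact: measurable_ker.
by apply: filterS W0 => z -> _.
Qed.

Lemma num_edges_gt0 (H : graph) : (0 < num_edges H)%N.
Proof.
have [u [v uv]] := has_edge H; apply/card_gt0P.
case: (ltngtP (enum_rank u) (enum_rank v)) => [uv'|vu|].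
- by exists (u, v); rewrite inE /= uv.
- by exists (v, u); rewrite inE /= adj_sym uv.
- by move=> /val_inj/enum_rank_inj uv'; rewrite uv' adj_irr in uv.
Qed.

Import HBNNSimple.

Lemma exprn_op_norm_le (R : realType) (C : symkernel R -> Prop) (H : graph)
    (W : symkernel R) : admissible C -> Sidorenko C H -> C W ->
    (num_vertices H <= num_edges H)%N -> 0 <= op_norm W ->
  op_norm W ^+ (2 * num_edges H - num_vertices H) <=
    edge_density W ^+ (num_edges H - num_vertices H) * hom_density W H.
Proof.
move=> admC sidC CW hH r0; set c := _ * hom_density W H.
set m := (2 * _ - _)%N.
have m0 : (0 < m)%N.
  rewrite subn_gt0 (leq_ltn_trans hH)// mul2n -addnn -[ltnLHS]addn0 ltn_add2l.
  exact: num_edges_gt0.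
have c0 : 0 <= c.
  rewrite mulr_ge0 ?hom_density_ge0 ?exprn_ge0//.
  by apply: Rintegral_ge0 => z _; case/andP: (ker_itv W z.1 z.2).
rewrite leNgt; apply/negP => clt.
(* A norm [l] strictly between the [m]-th root of [c] and [op_norm W] leaves
   room for the approximation by simple functions. *)
pose c' := c `^ m%:R^-1.
have c'0 : 0 <= c' by exact: powR_ge0.
have c'm : c' ^+ m = c.
  by rewrite -powR_mulrn// -powRrM mulVf ?powRr1// pnatr_eq0 -lt0n.
have c'r : c' < op_norm W by rewrite -(ltr_pXn2r m0) ?nnegrE// c'm.
pose l := (c' + op_norm W) / 2.
have [c'l lr] : c' < l /\ l < op_norm W by rewrite midf_lt//; rewrite midf_lt.
have l0 : 0 <= l by exact: le_trans (ltW c'l).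
have [f [h [K [F2 [H2 [KE F2E H2E K0 lK]]]]]] := exists_simple_pair l0 lr.
have [sf sfP] := nnsfun_finite_range f; have [sh shP] := nnsfun_finite_range h.
have : l ^+ m <= c.
  have sfs x : f x \in sf ++ sh by rewrite mem_cat sfP.
  have shs x : h x \in sf ++ sh by rewrite mem_cat shP orbT.
  have f0 x : 0 <= f x by [].
  have h0 x : 0 <= h x by [].
  exact: (simple_pair_le admC sidC CW hH (measurable_funPT f)
    (measurable_funPT h) f0 h0 sfs shs KE F2E H2E K0 l0 lK).
by rewrite leNgt -c'm ltr_pXn2r ?nnegrE// c'l.
Qed.

Theorem theorem1p3 (R : realType) (C : symkernel R -> Prop) (H : graph)
  (hC : admissible C) (hH : (num_vertices H <= num_edges H)%N) :
  Sidorenko C H <-> spectrally_Sidorenko C H.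
Proof.
have e0 := num_edges_gt0 H.
have ve2 : (num_vertices H <= 2 * num_edges H)%N.
  by rewrite (leq_trans hH)// leq_pmull.
have expE (W : symkernel R) : 0 < edge_density W ->
    op_norm W ^ ((2 * num_edges H)%:Z - (num_vertices H)%:Z) *
      edge_density W ^ ((num_vertices H)%:Z - (num_edges H)%:Z) =
    op_norm W ^+ (2 * num_edges H - num_vertices H) /
      edge_density W ^+ (num_edges H - num_vertices H).
  move=> p0; rewrite -[X in _ * _ ^ X]opprB -exprz_inv (subzn hH) (subzn ve2).
  by rewrite -!exprnP exprVn.
split => [sidC W CW nzW|specC W CW].
  have p0 := edge_density_gt0 nzW.
  rewrite (expE _ p0) ler_pdivrMr ?exprn_gt0// mulrC.
  apply: (exprn_op_norm_le hC) => //.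
  exact: le_trans (ltW p0) (edge_density_le_op_norm W).
(* The zero graphon is not covered by the spectral bound. *)
have [nzW|zW] := pselect (nonzero W); last first.
  by rewrite (edge_density_eq0 zW) expr0n eqn0Ngt e0 hom_density_ge0.
have p0 := edge_density_gt0 nzW.
have pr := edge_density_le_op_norm W.
apply: le_trans (specC W CW nzW); rewrite (expE _ p0).
rewrite ler_pdivlMr ?exprn_gt0// -exprD.
rewrite (_ : _ + _ = 2 * num_edges H - num_vertices H)%N; last first.
  by rewrite addnBA// mul2n addnn.
by rewrite lerXn2r ?nnegrE// ?(le_trans _ pr)// ltW.
Qed.
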